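(* Let $n\ge1$ and let $k_1<k_2<\dots<k_n$ be integers. The generating function $\sum_A \mathrm{W}(A)$ of arrowed monotone triangles $A$ with bottom row $(k_1,\dots,k_n)$ equals $$\prod_{i=1}^{n}\left(uX_i+vX_i^{-1}+w\right)\prod_{1\le p<q\le n}\left(u\,E_{k_p}+v\,E_{k_q}^{-1}+w\,E_{k_p}E_{k_q}^{-1}\right) s_{(k_n,k_{n-1},\dots,k_1)}(X_1,\dots,X_n),$$ where the operator expression is interpreted as follows: regard $(k_1,\dots,k_n)\mapsto s_{(k_n,\dots,k_1)}(X_1,\dots,X_n)$ as a function on $\mathbb{Z}^n$, expand the product of operators into a sum of monomials in the shift operators, apply each monomial to this function, and only afterwards evaluate at the given values $k_1,\dots,k_n$.
   Context: A monotone triangle with $n$ rows is a triangular array of integers $(m_{i,j})_{1\le j\le i\le n}$ (row $i$ has entries $m_{i,1},\dots,m_{i,i}$; row $n$ is the bottom row) with $m_{i+1,j}\le m_{i,j}\le m_{i+1,j+1}$ and $m_{i,j}<m_{i,j+1}$. The northwest-neighbour of $m_{i,j}$ is $m_{i-1,j-1}$ and its northeast-neighbour is $m_{i-1,j}$ (when they exist). An arrowed monotone triangle is a monotone triangle in which every entry carries a decoration from $\{\nwarrow,\nearrow,\nwarrow\!\nearrow\}$ such that: if an entry equals its northwest-neighbour then it carries $\nearrow$; if an entry equals its northeast-neighbour then it carries $\nwarrow$. Its weight is $$\mathrm{W}(A)=u^{\#\nearrow}v^{\#\nwarrow}w^{\#\nwarrow\nearrow}\prod_{i=1}^n X_i^{(\text{sum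 of row } i)-(\text{sum of row } i-1)+(\#\nearrow\text{ in row } i)-(\#\nwarrow\text{ in row } i)},$$ where $\#\nearrow$, $\#\nwarrow$, $\#\nwarrow\nearrow$ count entries carrying exactly that decoration, and the sum of row $0$ is $0$. $E_x$ is the shift operator $E_x p(x)=p(x+1)$. Extended Schur polynomial: for $\lambda=(\lambda_1,\dots,\lambda_n)\in\mathbb{Z}^n$, if $\lambda_i-i=\lambda_j-j$ for some $i<j$ then $s_\lambda=0$; otherwise let $\sigma$ be the permutation with $\lambda_{\sigma(1)}-\sigma(1)>\dots>\lambda_{\sigma(n)}-\sigma(n)$, choose an integer $p\ge0$ with $\lambda_{\sigma(n)}+n-\sigma(n)+p\ge0$, and set $s_\lambda(X_1,\dots,X_n)=\operatorname{sgn}(\sigma)\,s_\mu(X_1,\dots,X_n)\prod_i X_i^{-p}$ with $\mu_i=\lambda_{\sigma(i)}+i-\sigma(i)+p$, where $s_\mu$ is the usual Schur polynomial of the partition $\mu$ (this is independent of $p$). *)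

(* Defs.v *)
From mathcomp Require Import all_boot all_order all_algebra all_fingroup.
Set Implicit Arguments. Unset Strict Implicit. Unset Printing Implicit Defensive.
Import Order.TTheory GRing.Theory Num.Theory.
Local Open Scope ring_scope.

Section AMT.
Variables (F : fieldType) (n : nat).

Definition oord (i : nat) : option 'I_n := insub i.

(* Usual Schur polynomial s_mu(X_1..X_n) of a partition mu (a seq nat, *)
(* weakly decreasing, parts mu_1 = nth 0 mu 0, ...) as the sum over     *)
(* semistandard Young tableaux of shape mu (English convention, rows    *)
(* weakly increasing, columns strictly increasing) with entries in      *)
(* {1..n}, of the product of X_entry.                                   *)
(* A tableau is encoded as T : 'I_n * 'I_M -> 'I_n.+1 (M = sumn mu bounds *)
(* the row lengths), where cell (r,c) (0-based) lies in the shape iff   *)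
(* c < mu_r, the entry of a cell of the shape is its value in 1..n and  *)
(* cells outside the shape carry the dummy value 0.                     *)

Definition Xat (X : 'I_n -> F) (t : nat) : F :=
  if oord t is Some i then X i else 1.

Definition tab_ent (M : nat) (T : {ffun 'I_n * 'I_M -> 'I_n.+1}) (r c : nat) : nat :=
  match oord r, (insub c : option 'I_M) with
  | Some r', Some c' => T (r', c')
  | _, _ => 0%N
  end.

Definition is_ssyt (mu : seq nat) (T : {ffun 'I_n * 'I_(sumn mu) -> 'I_n.+1}) : bool :=
  [&& [forall rc : 'I_n * 'I_(sumn mu), (rc.2 < nth 0%N mu rc.1)%N == (T rc != ord0)],
      [forall r : 'I_n, forall c : 'I_(sumn mu),
         (c.+1 < nth 0%N mu r)%N ==> (tab_ent T r c <= tab_ent T r c.+1)%N] &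
      [forall r : 'I_n, forall c : 'I_(sumn mu),
         ((r.+1 < n)%N && (c < nth 0%N mu r.+1)%N) ==> (tab_ent T r c < tab_ent T r.+1 c)%N]].

Definition schur (X : 'I_n -> F) (mu : seq nat) : F :=
  \sum_(T : {ffun 'I_n * 'I_(sumn mu) -> 'I_n.+1} | is_ssyt T)
     \prod_(rc : 'I_n * 'I_(sumn mu) | (rc.2 < nth 0%N mu rc.1)%N) Xat X (T rc).-1.

(* Extended Schur polynomial s_lambda for lambda in Z^n, exactly as in  *)
(* the context: lambda_i is lam (i-1) (0-based ordinals).  The shift    *)
(* i - sigma(i) is the same for 0- and 1-based indices.  For p we take  *)
(* the admissible choice p = sum_i |lambda_i| (the definition is        *)
(* independent of p).                                                   *)

Definition ext_schur (X : 'I_n -> F) (lam : 'I_n -> int) : F :=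
  if [exists i : 'I_n, exists j : 'I_n, (i < j)%N && (lam i - i%:Z == lam j - j%:Z)]
  then 0
  else match [pick s : 'S_n | [forall i : 'I_n, forall j : 'I_n,
                 (i < j)%N ==> (lam (s j) - (s j)%:Z < lam (s i) - (s i)%:Z)]] with
       | Some s =>
           let p : nat := (\sum_(i < n) `|lam i|)%N in
           let mu := [seq absz (lam (s i) + i%:Z - (s i)%:Z + p%:Z) | i <- enum 'I_n] in
           (-1) ^+ odd_perm s * schur X mu * \prod_(i < n) (X i ^- p)
       | None => 0
       end.

(* Arrowed monotone triangles with bottom row k.                        *)
(* Rows r = 0..n-1 (row r here is row r+1 of the paper), entries       *)
(* m_{r,j}, j = 0..r.  Entries are encoded in 'I_(2B+1) with value     *)
(* t - B, where B = sum_i |k_i|; every entry of a monotone triangle     *)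
(* with bottom row k lies in [k_1,k_n], hence in [-B,B].  Decorations  *)
(* are encoded in 'I_3: 0 = nwarrow, 1 = nearrow, 2 = nwarrow-nearrow.  *)
(* Positions outside the triangle (j > r) carry the dummy value ord0.   *)

Definition bnd (k : 'I_n -> int) : nat := (\sum_(i < n) `|k i|)%N.

Definition ent (B : nat) (T : {ffun 'I_n * 'I_n -> 'I_(B.*2).+1}) (r j : nat) : int :=
  match oord r, oord j with
  | Some r', Some j' => (T (r', j') : nat)%:Z - B%:Z
  | _, _ => 0
  end.

Definition dec (D : {ffun 'I_n * 'I_n -> 'I_3}) (r j : nat) : nat :=
  match oord r, oord j with
  | Some r', Some j' => D (r', j')
  | _, _ => 3%N
  end.

Definition is_amt (k : 'I_n -> int)
  (TD : {ffun 'I_n * 'I_n -> 'I_((bnd k).*2).+1} * {ffun 'I_n * 'I_n -> 'I_3}) : bool :=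
  let T := TD.1 in let D := TD.2 in
  let e := ent T in let d := dec D in
  [&& [forall r : 'I_n, forall j : 'I_n,
         (r < j)%N ==> (T (r, j) == ord0) && (D (r, j) == ord0)],
      [forall j : 'I_n, e n.-1 j == k j],
      [forall r : 'I_n, forall j : 'I_n,
         ((r.+1 < n)%N && (j <= r)%N) ==> (e r.+1 j <= e r j) && (e r j <= e r.+1 j.+1)],
      [forall r : 'I_n, forall j : 'I_n, (j < r)%N ==> (e r j < e r j.+1)],
      [forall r : 'I_n, forall j : 'I_n,
         [&& (0 < r)%N, (0 < j)%N, (j <= r)%N & e r j == e r.-1 j.-1] ==> (d r j == 1%N)] &
      [forall r : 'I_n, forall j : 'I_n,
         [&& (0 < r)%N, (j < r)%N & e r j == e r.-1 j] ==> (d r j == 0%N)]].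

Definition rowsum (B : nat) (T : {ffun 'I_n * 'I_n -> 'I_(B.*2).+1}) (r : nat) : int :=
  \sum_(j < n | (j <= r)%N) ent T r j.

Definition prevsum (B : nat) (T : {ffun 'I_n * 'I_n -> 'I_(B.*2).+1}) (r : nat) : int :=
  if r is r'.+1 then rowsum T r' else 0.

Definition cnt (D : {ffun 'I_n * 'I_n -> 'I_3}) (c : nat) : nat :=
  #|[set rj : 'I_n * 'I_n | (rj.2 <= rj.1)%N && ((D rj : nat) == c)]|.

Definition rowcnt (D : {ffun 'I_n * 'I_n -> 'I_3}) (r : 'I_n) (c : nat) : nat :=
  #|[set j : 'I_n | (j <= r)%N && ((D (r, j) : nat) == c)]|.

Definition amt_weight (u v w : F) (X : 'I_n -> F) (B : nat)
  (TD : {ffun 'I_n * 'I_n -> 'I_(B.*2).+1} * {ffun 'I_n * 'I_n -> 'I_3}) : F :=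
  let T := TD.1 in let D := TD.2 in
  u ^+ cnt D 1 * v ^+ cnt D 0 * w ^+ cnt D 2 *
  \prod_(r < n) X r ^ (rowsum T r - prevsum T r
                       + (rowcnt D r 1)%:Z - (rowcnt D r 0)%:Z).

Definition amt_gf (u v w : F) (X : 'I_n -> F) (k : 'I_n -> int) : F :=
  \sum_(TD | @is_amt k TD) amt_weight u v w X TD.

Definition fn := ('I_n -> int) -> F.

Definition shift (p : 'I_n) (d : int) (f : fn) : fn :=
  fun l => f (fun i => l i + (if i == p then d else 0)).

Definition factor (u v w : F) (p q : 'I_n) (f : fn) : fn :=
  fun l => u * shift p 1 f l + v * shift q (-1) f l
           + w * shift p 1 (shift q (-1) f) l.

Definition opprod (u v w : F) : fn -> fn :=
  foldr (fun pq h => factor u v w pq.1 pq.2 \o h) id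
        [seq (p, q) | p : 'I_n <- enum 'I_n, q : 'I_n <- [seq q : 'I_n <- enum 'I_n | (p < q)%N]].

Definition schur_rev (X : 'I_n -> F) : fn :=
  fun l => ext_schur X (fun i => l (rev_ord i)).

Definition amt_rhs (u v w : F) (X : 'I_n -> F) (k : 'I_n -> int) : F :=
  (\prod_(i < n) (u * X i + v * (X i)^-1 + w)) * opprod u v w (schur_rev X) k.

End AMT.

(* Main.v *)
(* Regard everything as a function of the bottom row.  On the exponential
   k |-> prod_j x_(s j)^(k_j + j) the operator u E_p + v E_q^-1 + w E_p E_q^-1
   acts as the scalar u x_(s p) + v / x_(s q) + w x_(s p) / x_(s q), so by the
   bialternant formula the right-hand side times the Vandermonde determinant is
   an explicit signed sum over permutations, and the prefactors
   u X_i + v / X_i + w are exactly the diagonal scalars p = q.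

   The left-hand side obeys a recursion on rows.  Once the decorations of the
   bottom row are fixed, the next row ranges over a product of intervals (its
   strict monotonicity is automatic), so the exponentials are summed by geometric
   series.  Expanding these into their endpoint terms, the two terms that meet at
   the same entry of the bottom row cancel by antisymmetry, and the surviving
   terms are those of a permutation of one more variable.  The branching of
   semistandard tableaux is the case (u, v, w) = (0, 1, 0) of this recursion,
   which gives the bialternant formula.

   This assumes that the X_i are distinct.  In general the identity is proved over
   F(t) for X_i + t^(i+1) and specialised at t = 0. *)

Require Import Defs.
From mathcomp Require Import all_boot all_order all_algebra all_fingroup.
From mathcomp Require Import zify ring.
Set Implicit Arguments. Unset Strict Implicit. Unset Printing Implicit Defensive.
Import Order.TTheory GRing.Theory Num.Theory.
Local Open Scope ring_scope.

Lemma oordE (n : nat) (i : 'I_n) : oord n i = Some i.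
Proof. by rewrite /oord valK. Qed.

Lemma Xat_ord (K : fieldType) (n : nat) (X : 'I_n -> K) (i : 'I_n) : Xat X i = X i.
Proof. by rewrite /Xat oordE. Qed.

Lemma Xat_neq0 (K : fieldType) (n : nat) (X : 'I_n -> K) :
  (forall i, X i != 0) -> forall i, (i < n)%N -> Xat X i != 0.
Proof. by move=> X0 i lt; rewrite (Xat_ord X (Ordinal lt)). Qed.

Lemma Xat_neq (K : fieldType) (n : nat) (X : 'I_n -> K) :
  injective X -> forall i j, (i < j < n)%N -> Xat X i != Xat X j.
Proof.
move=> Xi i j /andP[ij jn]; have iN := ltn_trans ij jn.
by rewrite (Xat_ord X (Ordinal iN)) (Xat_ord X (Ordinal jn)) (inj_eq Xi) -val_eqE /= ltn_eqF.
Qed.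

Lemma prod_if_lt (R : comNzRingType) (a b : nat) (p q : R) :
  \prod_(j < a + b) (if (j < a)%N then p else q) = p ^+ a * q ^+ b.
Proof.
rewrite big_split_ord /= -[in RHS](card_ord a) -[in RHS](card_ord b) -!prodr_const.
congr (_ * _); apply: eq_bigr => i _ /=; first by rewrite ltn_ord.
by rewrite ltnNge leq_addr.
Qed.

Lemma sum_sign_tperm (R : pzRingType) m (i1 i2 : 'I_m) (G : 'S_m -> R) :
  i1 != i2 -> (forall s, G (tperm i1 i2 * s)%g = G s) ->
  \sum_(s : 'S_m) (-1) ^+ s * G s = 0.
Proof.
move=> ne inv; pose t := tperm i1 i2.
have oddMt s : (t * s)%g = ~~ s :> bool by rewrite odd_permM odd_tperm ne.
rewrite (bigID (@odd_perm _)) /=.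
apply: canLR (subrK _) _; rewrite add0r -sumrN.
rewrite (reindex_inj (mulgI t)); apply: eq_big => //= s.
by rewrite oddMt => /negPf->; rewrite mulN1r mul1r inv.
Qed.

Lemma sum_lift_perm (R : nmodType) m (G : 'S_m.+1 -> R) :
  \sum_s G s = \sum_(i < m.+1) \sum_(s : 'S_m) G (lift_perm i ord_max s).
Proof.
rewrite pair_big /= (reindex (fun p : 'I_m.+1 * 'S_m => lift_perm p.1 ord_max p.2)) //.
apply/onW_bij/inj_card_bij; last by rewrite card_prod card_ord !card_Sn factS.
move=> [i s] [j s'] /= e.
have ij : i = j.
  by apply: (@perm_inj _ (lift_perm i ord_max s)); rewrite {2}e !lift_perm_id.
rewrite -ij in e *; congr pair; apply/permP => a.
by apply: (@lift_inj _ ord_max); rewrite -!(lift_perm_lift i) e.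
Qed.

Section Staircase.
Variables (R : nmodType) (m : nat).
Definition stairs (i : 'I_m.+1) : {ffun 'I_m -> bool} := [ffun j : 'I_m => (i <= j)%N].

Lemma sum_stairs (G : {ffun 'I_m -> bool} -> R) :
  (forall (c : {ffun 'I_m -> bool}) (i j : 'I_m), j = i.+1 :> nat -> c i -> ~~ c j -> G c = 0) ->
  \sum_c G c = \sum_(i < m.+1) G (stairs i).
Proof.
move=> G0; pose P (c : {ffun 'I_m -> bool}) :=
  [forall i : 'I_m, forall j : 'I_m, (j == i.+1 :> nat) ==> c i ==> c j].
rewrite (bigID P) /= [X in _ + X]big1 ?addr0; last first.
  move=> c; rewrite negb_forall => /existsP[i]; rewrite negb_forall => /existsP[j].
  by rewrite !negb_imply => /and3P[/eqP ji ci cj]; apply: G0 ci cj.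
pose first c : 'I_m.+1 := inord (find (fun j : 'I_m => c j) (enum 'I_m)).
have first_le (c : {ffun 'I_m -> bool}) : (find (fun j : 'I_m => c j) (enum 'I_m) < m.+1)%N.
  by rewrite ltnS (leq_trans (find_size _ _)) // size_enum_ord.
rewrite (reindex_onto stairs first).
  apply: eq_bigl => i; apply/andP; split.
    apply/forallP => a; apply/forallP => b; apply/implyP => /eqP ba; apply/implyP.
    by rewrite !ffunE ba => /leqW.
  apply/eqP/val_inj; rewrite /= /first inordK //.
  set f := find _ _.
  have [lt_im|] := ltnP i m; last first.
    move=> le_mi; have ei : i = m :> nat by apply/eqP; rewrite eqn_leq le_mi -ltnS ltn_ord.
    rewrite ei /f -[RHS](size_enum_ord m); apply/eqP; rewrite eqn_leq find_size /= leqNgt -has_find.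
    by apply/hasPn => j _; rewrite ffunE -ltnNge ei.
  pose i' := Ordinal lt_im.
  have fi : (f <= i)%N.
    rewrite leqNgt; apply/negP => /(before_find i').
    by rewrite ffunE nth_enum_ord // leqnn.
  apply/eqP; rewrite eqn_leq fi /=.
  have hs : has (fun j : 'I_m => stairs i j) (enum 'I_m).
    by rewrite has_find size_enum_ord (leq_ltn_trans fi).
  move: (nth_find i' hs); rewrite ffunE nth_enum_ord //.
  exact: leq_ltn_trans fi _.
move=> c /forallP Pc; apply/ffunP => j; rewrite ffunE /first inordK //.
set f := find _ _; have [jf|fj] := ltnP j f; last first.
  have fm : (f < m)%N := leq_ltn_trans fj (ltn_ord j).
  have hs : has (fun j : 'I_m => c j) (enum 'I_m) by rewrite has_find size_enum_ord.
  have mono d : forall b : 'I_m, (b = f + d :> nat)%N -> c b.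
    elim: d => [|d IH] b eb.
      have := nth_find j hs; rewrite -/f.
      by rewrite addn0 in eb; rewrite -eb nth_ord_enum.
    have lt : (f + d < m)%N by have := ltn_ord b; lia.
    have /forallP/(_ b)/implyP/(_ _)/implyP := Pc (Ordinal lt); apply; first by rewrite /= eb addnS.
    exact: IH.
  by rewrite (mono (j - f)%N) //; lia.
by have := before_find j jf; rewrite nth_ord_enum => ->.
Qed.
End Staircase.

(** * Decorated box sums of alternating exponentials *)

Section BoxSum.
Variables (K : fieldType) (u v w : K).

(* Eigenvalue of u E_p + v E_q^-1 + w E_p E_q^-1 on exponentials with bases a at p
   and b at q. *)
Definition wt2 (a b : K) : K := u * a + v * b^-1 + w * (a * b^-1).

(* Encoding of the decorations as in [is_amt]: 0 = nwarrow, 1 = nearrow, 2 = both. *)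
Definition decw (t : K) (d : nat) : K :=
  match d with 0 => v * t^-1 | 1 => u * t | _ => w end.

(* Sum of y ^ l over a <= l <= b, see [sum_geo]. *)
Definition geo (y : K) (a b : int) : K := (y ^ (b + 1) - y ^ a) / (y - 1).

Section Fixed.
Variables (m : nat) (k : nat -> int).

Definition lo (d : {ffun 'I_m.+1 -> 'I_3}) (j : 'I_m) : int :=
  k j + (d (lift ord_max j) != 0%N :> nat)%:Z.
Definition hi (d : {ffun 'I_m.+1 -> 'I_3}) (j : 'I_m) : int :=
  k j.+1 - (d (lift ord0 j) != 1%N :> nat)%:Z.

(* [c j = true] selects the upper endpoint of the j-th geometric sum; it meets the
   bottom entry j.+1 through [argr], the lower endpoint meets entry j through [argl]. *)
Section Z.
Variables (t : K) (z : 'I_m -> K) (c : {ffun 'I_m -> bool}).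
Definition argl (i : 'I_m.+1) : K :=
  if unlift ord_max i is Some j then (if c j then t else z j) else t.
Definition argr (i : 'I_m.+1) : K :=
  if unlift ord0 i is Some j then (if c j then z j else t) else t.
Definition endpt (j : 'I_m) : K :=
  z j ^+ j * (if c j then (z j / t) ^ (k j.+1 + 1) else - (z j / t) ^ (k j)) / (z j / t - 1).
End Z.

Lemma prod_unlift (i0 : 'I_m.+1) (f : 'I_m -> K) :
  \prod_(i < m.+1) (if unlift i0 i is Some j then f j else 1) = \prod_(j < m) f j.
Proof.
rewrite (bigD1_ord i0) //= unlift_none mul1r.
by apply: eq_bigr => j _; rewrite liftK.
Qed.

Lemma sum_dec (t : K) (z : 'I_m -> K) : t != 0 -> (forall j, z j != 0) ->
  \sum_(d : {ffun 'I_m.+1 -> 'I_3}) (\prod_(i < m.+1) decw t (d i)) *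
     \prod_(j < m) (z j ^+ j * geo (z j / t) (lo d j) (hi d j))
  = \sum_(c : {ffun 'I_m -> bool}) (\prod_(j < m) endpt t z c j) * \prod_(i < m.+1) wt2 (argl t z c i) (argr t z c i).
Proof.
move=> t0 z0.
have y0 j : z j / t != 0 by rewrite mulf_neq0 ?invr_eq0.
pose H (d : {ffun 'I_m.+1 -> 'I_3}) j (b : bool) : K :=
  z j ^+ j * (if b then (z j / t) ^ (hi d j + 1) else - (z j / t) ^ (lo d j)) / (z j / t - 1).
under eq_bigr => d _.
  rewrite (_ : \prod_(j < m) _ = \prod_(j < m) \sum_(b : bool) H d j b); last first.
    by apply: eq_bigr => j _; rewrite big_bool /H /geo /= -mulrDl -mulrDr mulrA.
  rewrite bigA_distr_bigA big_distrr.
  over.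
rewrite exchange_big /=; apply: eq_bigr => c _.
pose up (i : 'I_m.+1) (e : 'I_3) : K :=
  if unlift ord0 i is Some j then
    (if c j then (z j / t) ^ (- (e != 1%N :> nat)%:Z) else 1) else 1.
pose dn (i : 'I_m.+1) (e : 'I_3) : K :=
  if unlift ord_max i is Some j then
    (if c j then 1 else (z j / t) ^ ((e != 0%N :> nat)%:Z)) else 1.
rewrite (_ : \prod_(i < m.+1) wt2 _ _ = \prod_(i < m.+1) \sum_(e : 'I_3) (decw t e * up i e * dn i e)).
  rewrite bigA_distr_bigA big_distrr; apply: eq_bigr => d _ /=.
  rewrite [X in _ = _ * X]big_split /= [X in _ = _ * (X * _)]big_split /= -mulrA [RHS]mulrCA; congr (_ * _).
  rewrite (_ : \prod_(i < m.+1) up i (d i) =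
    \prod_(j < m) (if c j then (z j / t) ^ (- (d (lift ord0 j) != 1%N :> nat)%:Z) else 1)); last first.
    rewrite -[RHS](prod_unlift ord0); apply: eq_bigr => i _; rewrite /up.
    by case: unliftP => // j ->.
  rewrite (_ : \prod_(i < m.+1) dn i (d i) =
    \prod_(j < m) (if c j then 1 else (z j / t) ^ ((d (lift ord_max j) != 0%N :> nat)%:Z))); last first.
    rewrite -[RHS](prod_unlift ord_max); apply: eq_bigr => i _; rewrite /dn.
    by case: unliftP => // j ->.
  rewrite -!big_split /=; apply: eq_bigr => j _; rewrite /H /endpt.
  case: (c j); rewrite /hi /lo.
    by rewrite mulr1 addrAC [in LHS]expfzDr // -!mulrA; congr (_ * (_ * _)); rewrite mulrC.
  by rewrite mul1r [in LHS]expfzDr // -mulNr -!mulrA; congr (_ * (_ * _)); rewrite mulrC.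
apply: eq_bigr => i _; rewrite !big_ord_recl big_ord0 /= addr0 /argl /argr /up /dn /wt2.
have nz (a b : bool) j : (if b then t else z j) != 0 by case: b.
case: (unliftP ord0 i) => [j|] _; case: (unliftP ord_max i) => [j'|] _ /=;
  try (case: (c j) => /=); try (case: (c j') => /=);
  rewrite ?expr0z ?oppr0 ?expr0z ?expr1z ?exprN1 ?mulr1 /=; field;
  rewrite ?t0 ?z0 //.
Qed.
End Fixed.

End BoxSum.

Section Core.
Variables (K : fieldType) (u v w : K).
Local Notation wt2 := (wt2 u v w).

Definition pairw (m : nat) (z : 'I_m -> K) : K :=
  \prod_(p : 'I_m) \prod_(q : 'I_m | (p <= q)%N) wt2 (z p) (z q).

Definition alt (x : nat -> K) (m : nat) (k : nat -> int) : K :=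
  \sum_(s : 'S_m) (-1) ^+ s * ((\prod_(j < m) x (s j) ^ (k j + j%:Z)) * pairw (fun j => x (s j))).

(* The endpoints chosen at i0 and j0 = i0.+1 meet at the same bottom entry, and the
   summand is symmetric under exchanging the two variables. *)
Lemma descent_cancel (m : nat) (k : nat -> int) (x : nat -> K) (t : K)
    (c : {ffun 'I_m -> bool}) (i0 j0 : 'I_m) :
  t != 0 -> (forall i, (i < m)%N -> x i != 0) ->
  j0 = i0.+1 :> nat -> c i0 -> ~~ c j0 ->
  \sum_(s : 'S_m) (-1) ^+ s * (pairw (fun j => x (s j)) *
     ((\prod_(j < m) endpt k t (fun j => x (s j)) c j) *
      \prod_(i < m.+1) wt2 (argl t (fun j => x (s j)) c i) (argr t (fun j => x (s j)) c i))) = 0.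
Proof.
move=> t0 x0 ji ci cj.
have neij : i0 != j0 by apply/eqP => e; move: ji; rewrite e; lia.
apply: (sum_sign_tperm neij) => s.
pose T := tperm i0 j0.
pose z := fun j => x (s j); pose z' := fun j => x ((T * s)%g j).
have z'E j : z' j = z (T j) by rewrite /z' permM.
have zi : z' i0 = z j0 by rewrite z'E tpermL.
have zj : z' j0 = z i0 by rewrite z'E tpermR.
have zo j : j != i0 -> j != j0 -> z' j = z j.
  by move=> ? ?; rewrite z'E tpermD // eq_sym.
pose i1 : 'I_m.+1 := lift ord_max j0.
have i1E : i1 = lift ord0 i0 by apply: val_inj; rewrite /= /bump leqNgt ltn_ord /= add0n ji add1n.
have argl1 y : argl t y c i1 = y j0 by rewrite /argl liftK (negbTE cj).
have argr1 y : argr t y c i1 = y i0 by rewrite /argr i1E liftK ci.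
have argo i : i != i1 -> (argl t z' c i = argl t z c i) * (argr t z' c i = argr t z c i).
  move=> ne; rewrite /argl /argr; split.
    case: unliftP => [j|] // ej; case cjj: (c j) => //; apply: zo.
      by apply: contraFneq cjj => ->.
    by apply: contraNneq ne => e; rewrite ej e.
  case: unliftP => [j|] // ej; case cjj: (c j) => //; apply: zo.
    by apply: contraNneq ne => e; rewrite ej e i1E.
  by apply: contraTneq cjj => ->.
have z0 j : z j != 0 by exact: x0.
have -> : \prod_(j < m) endpt k t z' c j = \prod_(j < m) endpt k t z c j.
  have ne' : j0 != i0 by rewrite eq_sym.
  rewrite (bigD1 i0) //= (bigD1 j0) //= [RHS](bigD1 i0) //= [X in _ = _ * X](bigD1 j0) //=.
  rewrite !mulrA; congr (_ * _); last first.
    by apply: eq_bigr => j /andP[? ?]; rewrite /endpt zo.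
  have y0 j : z j / t != 0 by rewrite mulf_neq0 ?invr_eq0.
  rewrite /endpt ci (negbTE cj) zi zj ji !expfzDr // !expr1z !exprS.
  set a := (z j0 / t) ^ _; set b := (z i0 / t) ^ _.
  set a' := z j0 ^+ i0; set b' := z i0 ^+ i0.
  set A := (z j0 / t - 1)^-1; set B := (z i0 / t - 1)^-1.
  by field.
have -> : pairw z' * (\prod_(j < m) endpt k t z c j *
    \prod_(i < m.+1) wt2 (argl t z' c i) (argr t z' c i)) =
  (\prod_(j < m) endpt k t z c j) * (pairw z' * wt2 (z' j0) (z' i0)) *
   \prod_(i < m.+1 | i != i1) wt2 (argl t z' c i) (argr t z' c i).
  by rewrite [in LHS](bigD1 i1) //= argl1 argr1; ring.
have -> : pairw z * (\prod_(j < m) endpt k t z c j *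
    \prod_(i < m.+1) wt2 (argl t z c i) (argr t z c i)) =
  (\prod_(j < m) endpt k t z c j) * (pairw z * wt2 (z j0) (z i0)) *
   \prod_(i < m.+1 | i != i1) wt2 (argl t z c i) (argr t z c i).
  by rewrite [in LHS](bigD1 i1) //= argl1 argr1; ring.
congr (_ * _ * _); last first.
  by apply: eq_bigr => i ne; case: (argo i ne) => -> ->.
pose P (pq : 'I_m * 'I_m) := (pq.1 <= pq.2)%N || (pq == (j0, i0)).
have pairwE y : pairw y * wt2 (y j0) (y i0) = \prod_(pq | P pq) wt2 (y pq.1) (y pq.2).
  rewrite (bigD1 (j0, i0)) /=; last by rewrite /P eqxx orbT.
  rewrite mulrC /pairw pair_big_dep /=; congr (_ * _); apply: eq_bigl => -[p q] /=.
  rewrite /P /= andb_orl; case: eqP => [[-> ->]|] /=; first by rewrite ji ltnn.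
  by rewrite andbT orbF.
rewrite !pairwE [RHS](reindex (fun pq : 'I_m * 'I_m => (T pq.1, T pq.2))) /=; last first.
  by exists (fun pq : 'I_m * 'I_m => (T pq.1, T pq.2)) => -[p q] _; rewrite /= !tpermK.
apply: eq_big => [[p q]|[p q] _]; last by rewrite /= -!z'E.
rewrite /P /= !xpair_eqE.
have tE r : (T r : nat) = if r == i0 then j0 : nat else if r == j0 then i0 : nat else r.
  by rewrite /T; case: tpermP => [->|->|/eqP/negPf-> /eqP/negPf->]; rewrite ?eqxx // eq_sym (negbTE neij).
rewrite -!val_eqE /= !tE -!val_eqE /= ji; do 4 (case: eqP => ? //=); lia.
Qed.

Lemma pairw_lift (m : nat) (i0 : 'I_m.+1) (t : K) (y : 'I_m.+1 -> K) (z : 'I_m -> K) :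
  y i0 = t -> (forall j, y (lift i0 j) = z j) ->
  pairw y = pairw z *
    \prod_(i < m.+1) wt2 (argl t z (stairs i0) i) (argr t z (stairs i0) i).
Proof.
move=> yi yl.
have lelift (p q : 'I_m) : (lift i0 p <= lift i0 q)%N = (p <= q)%N by rewrite /= leq_bump2.
rewrite /pairw [LHS](bigD1_ord i0) //= (bigD1_ord i0) //= yi.
have -> : \prod_(p < m) \prod_(q < m.+1 | (lift i0 p <= q)%N) wt2 (y (lift i0 p)) (y q) =
  \prod_(p < m) ((if (bump i0 p <= i0)%N then wt2 (z p) t else 1) *
     \prod_(q < m | (p <= q)%N) wt2 (z p) (z q)).
  apply: eq_bigr => p _; rewrite big_mkcond (bigD1_ord i0) //= yl yi; congr (_ * _).
  by rewrite -big_mkcond /=; apply: eq_big => [q|q _]; rewrite ?leq_bump2 ?yl.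
rewrite big_split /= [RHS]mulrC (bigD1_ord i0) //= -!mulrA.
congr (_ * _); last rewrite mulrA [in LHS]mulrC [in RHS]mulrC; last congr (_ * _).
  congr wt2; rewrite /argl /argr; case: unliftP => // j ej; rewrite ffunE.
    by rewrite (_ : i0 = j :> nat) ?leqnn // ej /= /bump leqNgt ltn_ord.
  by rewrite (_ : i0 = j.+1 :> nat) ?ltnn // ej.
rewrite big_mkcond -big_split /=; apply: eq_bigr => j _; rewrite yl.
rewrite /bump; have [le|lt] /= := leqP i0 j; last first.
  rewrite leqNgt lt /= mul1r ifT; last by lia.
  have -> : lift i0 j = lift ord_max j by apply: val_inj; rewrite /= /bump leqNgt lt /= leqNgt ltn_ord.
  rewrite /argl liftK ffunE leqNgt lt /=; congr wt2; rewrite /argr.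
  case: unliftP => // j' ej; rewrite ffunE ifN // -ltnNge.
  by move/(congr1 val): ej; rewrite /= /bump leq0n leqNgt ltn_ord /=; lia.
rewrite leqW //= [X in _ * X]ifN ?mulr1; last by lia.
have -> : lift i0 j = lift ord0 j by apply: val_inj; rewrite /= /bump le.
rewrite /argr liftK ffunE le; congr wt2; rewrite /argl.
case: unliftP => // j' ej; rewrite ffunE ifT //.
by move/(congr1 val): ej; rewrite /= /bump leq0n (leqNgt m) ltn_ord /=; lia.
Qed.

Lemma stairs_term (m : nat) (k : nat -> int) (x : nat -> K) (s : 'S_m) (i0 : 'I_m.+1) :
  x m != 0 -> (forall i, (i < m)%N -> x i != 0) -> (forall i, (i < m)%N -> x i != x m) ->
  (\prod_(i < m) (x m - x i)) * x m ^ (\sum_(j < m.+1) k j) *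
   ((-1) ^+ s * (pairw (fun j => x (s j)) *
     ((\prod_(j < m) endpt k (x m) (fun j => x (s j)) (stairs i0) j) *
      \prod_(i < m.+1) wt2 (argl (x m) (fun j => x (s j)) (stairs i0) i)
                           (argr (x m) (fun j => x (s j)) (stairs i0) i)))) =
  (-1) ^+ lift_perm i0 ord_max s *
   ((\prod_(j < m.+1) x (lift_perm i0 ord_max s j) ^ (k j + j%:Z)) *
    pairw (fun j => x (lift_perm i0 ord_max s j))).
Proof.
move=> t0 x0 xt; set t := x m; set s' := lift_perm _ _ _.
pose z (j : 'I_m) := x (s j).
have s'l j : x (s' (lift i0 j)) = z j.
  by rewrite lift_perm_lift /= /bump leqNgt ltn_ord.
rewrite (@pairw_lift m i0 t _ z) //; last by rewrite lift_perm_id.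
rewrite -/z; set W := pairw z; set W' := \prod_(i < m.+1) wt2 _ _.
have -> : \prod_(i < m) (t - x i) = \prod_(j < m) (t - z j).
  by rewrite (reindex_perm s).
rewrite (bigD1_ord i0) //= [X in _ = _ * (X * _)](bigD1_ord i0) //= lift_perm_id.
rewrite !(expfzDr _ _ t0) -/t -exprnP.
have -> : t ^ (\sum_(i < m) k (bump i0 i)) = \prod_(j < m) t ^ k (bump i0 j).
  elim/big_rec2: _ => [|j a b _ <-]; first by rewrite expr0z.
  by rewrite expfzDr.
have key : (\prod_(j < m) (t - z j)) * (\prod_(j < m) t ^ k (bump i0 j)) *
   (\prod_(j < m) endpt k t z (stairs i0) j) =
   (t ^+ i0 * (-1) ^+ (m - i0)) * \prod_(j < m) x (s' (lift i0 j)) ^ (k (bump i0 j) + (bump i0 j)%:Z).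
  have -> : t ^+ i0 * (-1) ^+ (m - i0) = \prod_(j < m) (if (j < i0)%N then t else -1).
    rewrite -prod_if_lt; have e : (i0 + (m - i0) = m)%N by rewrite subnKC // -ltnS.
    by rewrite e.
  rewrite -!big_split /=; apply: eq_bigr => j _; rewrite s'l /endpt ffunE /bump.
  have zt : z j - t != 0 by rewrite subr_eq0 xt.
  have z0 : z j != 0 by exact: x0.
  have tt0 : t != 0 := t0.
  rewrite !expfzDr // ?mulf_neq0 ?invr_eq0 // !expfzMl -!expfV.
  case: leqP => le /=.
    rewrite add1n -exprnP exprS !expr1z.
    by field; rewrite mulN1r expfz_neq0 // tt0 zt.
  rewrite add0n -exprnP.
  by field; rewrite mulN1r expfz_neq0 // tt0 zt.
have -> : (-1) ^+ s' = (-1) ^+ s * (-1) ^+ (m - i0) :> K.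
  rewrite odd_lift_perm signr_addb mulrC; congr (_ * _).
  by rewrite -[in RHS]signr_odd oddB -1?ltnS // addbC.
have alg (A B C D a e f g p q : K) : A * B * C = p * q * D ->
    A * (a * B) * (e * (f * (C * g))) = e * q * (a * p * D * (f * g)).
  move=> h; transitivity (A * B * C * (a * e * f * g)); first by ring.
  by rewrite h; ring.
exact: alg.
Qed.

Theorem alt_rec (m : nat) (k : nat -> int) (x : nat -> K) :
  x m != 0 -> (forall i, (i < m)%N -> x i != 0) -> (forall i, (i < m)%N -> x i != x m) ->
  alt x m.+1 k = (\prod_(i < m) (x m - x i)) * x m ^ (\sum_(j < m.+1) k j) *
    \sum_(d : {ffun 'I_m.+1 -> 'I_3}) (\prod_(i < m.+1) decw u v w (x m) (d i)) *
    \sum_(s : 'S_m) (-1) ^+ s * ((\prod_(j < m) (x (s j) ^+ j *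
        geo (x (s j) / x m) (lo k d j) (hi k d j))) * pairw (fun j => x (s j))).
Proof.
move=> t0 x0 xt.
set C := _ * _ ^ _; pose z (s : 'S_m) j := x (s j).
transitivity (C * \sum_(s : 'S_m) \sum_(c : {ffun 'I_m -> bool}) (-1) ^+ s * (pairw (z s) *
    ((\prod_(j < m) endpt k (x m) (z s) c j) *
      \prod_(i < m.+1) wt2 (argl (x m) (z s) c i) (argr (x m) (z s) c i)))); last first.
  congr (_ * _).
  transitivity (\sum_(s : 'S_m) (-1) ^+ s * (pairw (z s) *
    \sum_(d : {ffun 'I_m.+1 -> 'I_3}) (\prod_(i < m.+1) decw u v w (x m) (d i)) *
     \prod_(j < m) (z s j ^+ j * geo (z s j / x m) (lo k d j) (hi k d j)))).
    apply: eq_bigr => s _; rewrite sum_dec // => [|j]; last exact: x0.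
    by rewrite !big_distrr.
  under eq_bigr => s _ do rewrite !big_distrr /=.
  rewrite exchange_big; apply: eq_bigr => d _; rewrite big_distrr; apply: eq_bigr => s _ /=.
  by rewrite [RHS]mulrCA; congr (_ * _); rewrite mulrC -mulrA.
rewrite exchange_big /= sum_stairs; last first.
  move=> c i j ji ci cj; exact: descent_cancel ji ci cj.
rewrite big_distrr /alt sum_lift_perm; apply: eq_bigr => i _.
rewrite big_distrr; apply: eq_bigr => s _.
by rewrite -stairs_term.
Qed.
End Core.

Lemma sum_geo (K : fieldType) (y : K) (N : nat) (s a b : int) :
  y != 0 -> y != 1 -> s <= a -> a <= b + 1 -> b < N%:Z + s ->
  \sum_(t < N | (a <= t%:Z + s) && (t%:Z + s <= b)) y ^ (t%:Z + s) = geo y a b.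
Proof.
move=> y0 y1 sa ab bN.
have [n eb] : exists n : nat, b = a + n%:Z - 1 by exists (absz (b + 1 - a)%R); lia.
have y1' : y - 1 != 0 by rewrite subr_eq0.
subst b; elim: n ab bN => [|n IH] ab bN.
  rewrite big_pred0 ?/geo => [|t]; last by apply/negbTE; lia.
  by rewrite addr0 subrK subrr mul0r.
have tN : (absz (a + n%:Z - s)%R < N)%N by lia.
rewrite (bigD1 (Ordinal tN)) /=; last by lia.
rewrite (eq_bigl (fun t : 'I_N => (a <= t%:Z + s) && (t%:Z + s <= a + n%:Z - 1))); last first.
  by move=> t; rewrite -val_eqE /=; apply/idP/idP; lia.
rewrite IH; [|lia|lia].
rewrite /geo !subrK (_ : (absz (a + n%:Z - s)%R)%:Z + s = a + n%:Z); last by lia.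
rewrite (_ : a + n.+1%:Z = (a + n%:Z) + 1); last by lia.
by rewrite (expfzDr _ 1) // expr1z; field.
Qed.

Lemma sum_ffun_recr (R : nmodType) (S : finType) m (G : {ffun 'I_m.+1 -> S} -> R) :
  \sum_f G f = \sum_(s : S) \sum_(f : {ffun 'I_m -> S})
     G [ffun i => if unlift ord_max i is Some j then f j else s].
Proof.
rewrite pair_big /=.
rewrite (reindex (fun p : S * {ffun 'I_m -> S} =>
   [ffun i => if unlift ord_max i is Some j then p.2 j else p.1])) //=.
exists (fun f : {ffun 'I_m.+1 -> S} => (f ord_max, [ffun j => f (lift ord_max j)])).
  move=> [s f] _ /=; rewrite ffunE unlift_none; congr pair.
  by apply/ffunP => j; rewrite !ffunE liftK.
move=> f _; apply/ffunP => i; rewrite !ffunE /=.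
by case: unliftP => [j|] ->; rewrite ?ffunE.
Qed.

Section Chain.
Variables (R : comNzRingType) (S : finType) (s0 : S) (t : nat -> S -> S -> R).

Definition prevs m (f : {ffun 'I_m -> S}) (r : nat) : S :=
  if r is r'.+1 then (if insub r' is Some i then f i else s0) else s0.

Fixpoint chain m (s : S) : R :=
  if m is m'.+1 then \sum_s' chain m' s' * t m s' s else t 0 s0 s.

Lemma sum_chain m (G : S -> R) :
  \sum_(f : {ffun 'I_m.+1 -> S}) G (f ord_max) * \prod_(r < m.+1) t r (prevs f r) (f r) =
  \sum_s G s * chain m s.
Proof.
elim: m G => [|m IH] G.
  rewrite sum_ffun_recr; apply: eq_bigr => s _.
  have e (f : {ffun 'I_0 -> S}) : f = [ffun=> s0] by apply/ffunP => -[].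
  rewrite (bigD1 [ffun=> s0]) //= [X in _ + X]big1 => [|f /negP[]]; last exact/eqP/e.
  by rewrite addr0 big_ord1 ffunE unlift_none /= (_ : ord0 = ord_max) ?ffunE ?unlift_none //; apply: val_inj.
rewrite sum_ffun_recr; apply: eq_bigr => s _ /=.
under [in RHS]eq_bigr => s' _ do rewrite mulrC.
rewrite -(IH (fun s' => t m.+1 s' s)) !big_distrr; apply: eq_bigr => f _.
set g := [ffun i => _]; have gm : g ord_max = s by rewrite ffunE unlift_none.
have gl j : g (lift ord_max j) = f j by rewrite ffunE liftK.
rewrite gm big_ord_recr /= insubT //= => lt; congr (_ * _); rewrite mulrC gm.
congr (_ * _).
  congr t; rewrite -gl; congr (g _); apply: val_inj; rewrite /= /bump; lia.
apply: eq_bigr => r _; rewrite -gl; congr t; last first.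
  by congr (g _); apply: val_inj; rewrite /= /bump leqNgt ltn_ord.
case: r => -[|r] //= lr; rewrite insubT /=; first by lia.
move=> lt'; rewrite insubT /=; first by lia.
move=> lt''; rewrite -gl; congr (g _); apply: val_inj; rewrite /= /bump; lia.
Qed.
End Chain.

Section Extend.
Variables (S : finType) (s0 : S) (N r : nat).
Definition extf (f : {ffun 'I_r -> S}) : {ffun 'I_N -> S} :=
  [ffun j : 'I_N => if insub (j : nat) is Some i then f i else s0].

Lemma sum_extf (R : nmodType) (G : {ffun 'I_N -> S} -> R) : (r <= N)%N ->
  (forall f : {ffun 'I_N -> S}, ~~ [forall j : 'I_N, (r <= j)%N ==> (f j == s0)] -> G f = 0) ->
  \sum_f G f = \sum_(f : {ffun 'I_r -> S}) G (extf f).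
Proof.
move=> le G0; rewrite (bigID (fun f : {ffun 'I_N -> S} => [forall j : 'I_N, (r <= j)%N ==> (f j == s0)])) /=.
rewrite [X in _ + X]big1 ?addr0 //.
rewrite (reindex_onto extf (fun f : {ffun 'I_N -> S} => [ffun j => f (widen_ord le j)])).
  apply: eq_bigl => f; apply/andP; split.
    by apply/forallP => j; rewrite ffunE; apply/implyP => rj; rewrite insubF // ltnNge rj.
  apply/eqP/ffunP => j; rewrite !ffunE /= insubT //= => lt; congr (f _); exact: val_inj.
move=> f /forallP fP; apply/ffunP => j; rewrite ffunE.
case: insubP => [i _ ij|nlt]; first by rewrite ffunE; congr (f _); apply: val_inj; rewrite /= ij.
by apply/esym/eqP; apply: (implyP (fP j)); rewrite leqNgt.
Qed.

Lemma extfE (f : {ffun 'I_r -> S}) (j : 'I_N) (i : 'I_r) : j = i :> nat -> extf f j = f i.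
Proof. by move=> e; rewrite ffunE e valK. Qed.
End Extend.

Lemma prod_natr_bool (R : comNzRingType) (I : finType) (b : I -> bool) :
  \prod_i (b i)%:R = [forall i, b i]%:R :> R.
Proof.
case: forallP => [bT|/forallP]; first by apply: big1 => i _; rewrite bT.
by rewrite negb_forall => /existsP[i /negPf bi]; rewrite (bigD1 i) //= bi mul0r.
Qed.

(** * Recursion on the rows of an arrowed monotone triangle *)

Section Rows.
Variables (K : fieldType) (u v w : K) (m B : nat).
Local Notation N := m.+1.
Local Notation L := {ffun 'I_N -> 'I_(B.*2).+1}.
Local Notation D := {ffun 'I_N -> 'I_3}.

Definition rent (l : L) (j : nat) : int :=
  if oord N j is Some j' then (l j' : nat)%:Z - B%:Z else 0.

Definition okrow (r : nat) (l' l : L) (d : D) : bool :=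
  [&& [forall j : 'I_N, (r < j)%N ==> (l j == ord0) && (d j == ord0)],
   [forall j : 'I_N, (j < r)%N ==> (rent l j < rent l j.+1)],
   [forall j : 'I_N, (j < r)%N ==> (rent l j <= rent l' j) && (rent l' j <= rent l j.+1)],
   [forall j : 'I_N, [&& (0 < r)%N, (0 < j)%N, (j <= r)%N & rent l j == rent l' j.-1]
      ==> (d j == 1%N :> nat)] &
   [forall j : 'I_N, [&& (0 < r)%N, (j < r)%N & rent l j == rent l' j]
      ==> (d j == 0%N :> nat)]].

Definition rsum (r : nat) (l : L) : int := \sum_(j < N | (j < r)%N) rent l j.

Definition rstep (x : nat -> K) (r : nat) (s' s : L * D) : K :=
  (okrow r s'.1 s.1 s.2)%:R *
  ((\prod_(j < N | (j <= r)%N) decw u v w (x r) (s.2 j)) *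
   x r ^ (rsum r.+1 s.1 - rsum r s'.1)).

Definition zrow : L * D := ([ffun=> ord0], [ffun=> ord0]).

Definition stack (f : {ffun 'I_N -> L * D}) :
    {ffun 'I_N * 'I_N -> 'I_(B.*2).+1} * {ffun 'I_N * 'I_N -> 'I_3} :=
  ([ffun rj => (f rj.1).1 rj.2], [ffun rj => (f rj.1).2 rj.2]).

Lemma stack_bij : bijective stack.
Proof.
exists (fun TD : {ffun 'I_N * 'I_N -> 'I_(B.*2).+1} * {ffun 'I_N * 'I_N -> 'I_3} =>
  [ffun r => ([ffun j => TD.1 (r, j)], [ffun j => TD.2 (r, j)])]).
  move=> f; apply/ffunP => r; rewrite ffunE; case e: (f r) => [a b].
  by congr pair; apply/ffunP => j; rewrite !ffunE e.
by move=> [T C]; congr pair; apply/ffunP => -[r j]; rewrite !ffunE.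
Qed.

Lemma ent_stack f (r : 'I_N) j : ent (stack f).1 r j = rent (f r).1 j.
Proof. by rewrite /ent /rent oordE; case: oord => // j'; rewrite ffunE. Qed.

Lemma dec_stack f (r j : 'I_N) : dec (stack f).2 r j = (f r).2 j.
Proof. by rewrite /dec !oordE ffunE. Qed.

Lemma prevsE (f : {ffun 'I_N -> L * D}) (r r' : 'I_N) : r = r'.+1 :> nat -> prevs zrow f r = f r'.
Proof. by move=> ->; rewrite /= valK. Qed.

Lemma is_amt_stack (k : 'I_N -> int)
   (f : {ffun 'I_N -> L * D}) :
  [&& [forall r : 'I_N, forall j : 'I_N,
         (r < j)%N ==> ((stack f).1 (r, j) == ord0) && ((stack f).2 (r, j) == ord0)],
      [forall j : 'I_N, ent (stack f).1 N.-1 j == k j],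
      [forall r : 'I_N, forall j : 'I_N,
         ((r.+1 < N)%N && (j <= r)%N) ==>
           (ent (stack f).1 r.+1 j <= ent (stack f).1 r j) &&
           (ent (stack f).1 r j <= ent (stack f).1 r.+1 j.+1)],
      [forall r : 'I_N, forall j : 'I_N, (j < r)%N ==>
           (ent (stack f).1 r j < ent (stack f).1 r j.+1)],
      [forall r : 'I_N, forall j : 'I_N,
         [&& (0 < r)%N, (0 < j)%N, (j <= r)%N &
           ent (stack f).1 r j == ent (stack f).1 r.-1 j.-1] ==> (dec (stack f).2 r j == 1%N)] &
      [forall r : 'I_N, forall j : 'I_N,
         [&& (0 < r)%N, (j < r)%N & ent (stack f).1 r j == ent (stack f).1 r.-1 j] ==>
           (dec (stack f).2 r j == 0%N)]]
  = [forall j : 'I_N, rent (f ord_max).1 j == k j] &&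
    [forall r : 'I_N, okrow r (prevs zrow f r).1 (f r).1 (f r).2].
Proof.
have pr (r : 'I_N) (r0 : (0 < r)%N) : exists r' : 'I_N, r = r'.+1 :> nat.
  have lt : (r.-1 < N)%N by apply: leq_ltn_trans (ltn_ord r); lia.
  by exists (Ordinal lt) => /=; lia.
apply/idP/idP.
  case/and5P => /forallP H1 /forallP H2 /forallP H3 /forallP H4 /andP[/forallP H5 /forallP H6].
  apply/andP; split; first apply/forallP => j.
    by rewrite -ent_stack; apply: H2.
  apply/forallP => r; apply/and5P; split; apply/forallP => j; apply/implyP.
  - by move=> rj; have /forallP/(_ j)/implyP/(_ rj) := H1 r; rewrite !ffunE.
  - by move=> rj; have /forallP/(_ j)/implyP/(_ rj) := H4 r; rewrite !ent_stack.
  - move=> rj; case: (pr r); first exact: leq_ltn_trans rj.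
    move=> r' e; have := H3 r' => /forallP/(_ j); rewrite -e (prevsE f e) ltn_ord /=.
    by rewrite -ltnS -e rj /= !ent_stack.
  - case/and4P => r0 j0 jr; case: (pr r r0) => r' e; rewrite (prevsE f e) => h.
    have := H5 r => /forallP/(_ j)/implyP; rewrite dec_stack; apply.
    by rewrite r0 j0 jr ent_stack e /= ent_stack.
  case/and3P => r0 jr; case: (pr r r0) => r' e; rewrite (prevsE f e) => h.
  have := H6 r => /forallP/(_ j)/implyP; rewrite dec_stack; apply.
  by rewrite r0 jr ent_stack e /= ent_stack.
case/andP => /forallP H0 /forallP H.
have {H}H r := and5P (H r).
apply/and5P; split; last (apply/andP; split); apply/forallP => r.
- case: (H r) => /forallP h _ _ _ _; apply/forallP => j.
  by rewrite !ffunE; apply: h.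
- by rewrite (_ : N.-1 = (ord_max : 'I_N)) // ent_stack.
- apply/forallP => j; apply/implyP => /andP[lt jr].
  case: (H (Ordinal lt)) => _ _ /forallP/(_ j)/implyP h _ _.
  rewrite (@prevsE f _ r) // in h.
  by rewrite -[r.+1]/(val (Ordinal lt)) !ent_stack; apply: h.
- case: (H r) => _ /forallP h _ _ _; apply/forallP => j.
  by rewrite !ent_stack; apply: h.
- apply/forallP => j; apply/implyP => /and4P[r0 j0 jr]; rewrite dec_stack.
  case: (H r) => _ _ _ /forallP/(_ j)/implyP h _; case: (pr r r0) => r' e; move: h.
  rewrite (prevsE f e) => h ee; apply: h; rewrite r0 j0 jr.
  by move: ee; rewrite ent_stack [X in X.-1]e /= ent_stack.
apply/forallP => j; apply/implyP => /and3P[r0 jr]; rewrite dec_stack.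
case: (H r) => _ _ _ _ /forallP/(_ j)/implyP h; case: (pr r r0) => r' e; move: h.
rewrite (prevsE f e) => h ee; apply: h; rewrite r0 jr.
by move: ee; rewrite ent_stack [X in X.-1]e /= ent_stack.
Qed.

Lemma weight_stack (X : 'I_N -> K) (f : {ffun 'I_N -> L * D}) :
  (forall i, X i != 0) ->
  amt_weight u v w X (stack f) =
  \prod_(r < N) ((\prod_(j < N | (j <= r)%N) decw u v w (Xat X r) ((f r).2 j)) *
     Xat X r ^ (rsum r.+1 (f r).1 - rsum r (prevs zrow f r).1)).
Proof.
move=> X0; rewrite /amt_weight.
have cntE (a : K) c : a ^+ cnt (stack f).2 c =
    \prod_(r < N) \prod_(j < N | (j <= r)%N) (if (f r).2 j == c :> nat then a else 1).
  rewrite /cnt -prodr_const pair_big_dep /= -big_mkcondr /=.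
  by apply: eq_bigl => -[r j]; rewrite inE /= ffunE.
have rcntE (a : K) r c : a ^+ rowcnt (stack f).2 r c =
    \prod_(j < N | (j <= r)%N) (if (f r).2 j == c :> nat then a else 1).
  rewrite /rowcnt -prodr_const -big_mkcondr /=.
  by apply: eq_bigl => j; rewrite inE /= ffunE.
rewrite !cntE -!big_split /=; apply: eq_bigr => r _.
have xr := Xat_ord X r.
have -> : rowsum (stack f).1 r = rsum r.+1 (f r).1.
  by apply: eq_bigr => j _; rewrite ent_stack.
have -> : prevsum (stack f).1 r = rsum r (prevs zrow f r).1.
  case e: (r : nat) => [|r'] /=; first by rewrite /rsum big_pred0.
  have lt : (r' < N)%N by rewrite ltnW // -e.
  by rewrite insubT; apply: eq_bigr => j _; rewrite -ent_stack.
rewrite xr; move: (rsum _ _ - rsum _ _) => e.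
move: rcntE => /= rcntE.
rewrite -addrA !expfzDr // -invr_expz -!exprnP -exprVn !rcntE.
rewrite [X in _ * X]mulrC !mulrA; congr (_ * _); rewrite -!big_split /=; apply: eq_bigr => j _.
by case: ((f r).2 j) => -[|[|[|//]]] /= _; rewrite ?mul1r ?mulr1.
Qed.

End Rows.

Lemma amt_gf_chain (K : fieldType) (u v w : K) (m : nat) (X : 'I_m.+1 -> K) (k : 'I_m.+1 -> int) :
  (forall i, X i != 0) ->
  amt_gf u v w X k =
  \sum_s [forall j : 'I_m.+1, rent s.1 j == k j]%:R *
     chain (zrow m (bnd k)) (rstep u v w (Xat X)) m s.
Proof.
move=> X0; rewrite -sum_chain /amt_gf.
rewrite (reindex (@stack m (bnd k))) /=; last exact/onW_bij/stack_bij.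
rewrite big_mkcond; apply: eq_bigr => f _.
have isE := is_amt_stack k f; rewrite /is_amt [X in if X then _ else _]isE.
rewrite weight_stack // /rstep [in RHS]big_split /= mulrA prod_natr_bool -natrM mulnb.
by case: ifP => _; rewrite ?mul1r ?mul0r.
Qed.

Definition vdm (K : fieldType) (x : nat -> K) (m : nat) : K :=
  \prod_(q < m) \prod_(p < q) (x q - x p).

Lemma vdmS (K : fieldType) (x : nat -> K) m :
  vdm x m.+1 = vdm x m * \prod_(p < m) (x m - x p).
Proof. by rewrite /vdm big_ord_recr. Qed.

Lemma vdm_neq0 (K : fieldType) (x : nat -> K) m :
  (forall i j, (i < j < m)%N -> x i != x j) -> vdm x m != 0.
Proof.
move=> xd; apply/prodf_neq0 => q _; apply/prodf_neq0 => p _.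
by rewrite subr_eq0 eq_sym xd // !ltn_ord.
Qed.

Section Step.
Variables (K : fieldType) (u v w : K) (m B : nat).
Local Notation N := m.+1.
Local Notation L := {ffun 'I_N -> 'I_(B.*2).+1}.
Local Notation D := {ffun 'I_N -> 'I_3}.

Definition valid (r : nat) (l : L) : bool :=
  [forall j : 'I_N, (r <= j)%N ==> (l j == ord0)] &&
  [forall j : 'I_N, (j.+1 < r)%N ==> (rent l j < rent l j.+1)].

Lemma rentE (l : L) (j : 'I_N) : rent l j = (l j : nat)%:Z - B%:Z.
Proof. by rewrite /rent oordE. Qed.

Lemma okrow_valid r (l' l : L) (d : D) : okrow r l' l d -> valid r.+1 l.
Proof.
case/and5P => /forallP h1 /forallP h2 _ _ _; apply/andP; split; apply/forallP => j.
  by apply/implyP => rj; have /implyP/(_ rj)/andP[] := h1 j.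
by rewrite ltnS.
Qed.

Lemma okrow_box r (l : L) (l' : {ffun 'I_r -> 'I_(B.*2).+1}) (d : {ffun 'I_r.+1 -> 'I_3}) :
  (r < N)%N -> valid r.+1 l ->
  valid r (extf ord0 N l') && okrow r (extf ord0 N l') l (extf ord0 N d) =
  [forall j : 'I_r, (lo (rent l) d j <= (l' j : nat)%:Z - B%:Z) &&
                    ((l' j : nat)%:Z - B%:Z <= hi (rent l) d j)].
Proof.
move=> rN /andP[/forallP v1 /forallP v2].
have lift0 (j : 'I_r.+1) : (j < N)%N by apply: leq_trans (ltn_ord j) _.
have rl (j : 'I_r) (j' : nat) : j' = j :> nat -> rent (extf ord0 N l') j' = (l' j : nat)%:Z - B%:Z.
  move=> ->; have jN : (j < N)%N by apply: ltn_trans (ltn_ord j) rN.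
  by rewrite (rentE _ (Ordinal jN)) (@extfE _ _ _ _ _ _ j).
have dl (j : 'I_r.+1) (j' : 'I_N) : j' = j :> nat -> extf ord0 N d j' = d j.
  by move=> e; rewrite (@extfE _ _ _ _ _ _ j).
have lm (j : 'I_r) : (lift ord_max j : 'I_r.+1) = j :> nat.
  by rewrite /= /bump leqNgt ltn_ord.
apply/idP/forallP.
  case/andP => _ /and5P[_ _ /forallP h3 /forallP h4 /forallP h5] j.
  have jN : (j < N)%N by apply: ltn_trans (ltn_ord j) rN.
  have jN' : (j.+1 < N)%N by apply: leq_ltn_trans (ltn_ord j) rN.
  have r0 : (0 < r)%N by apply: leq_ltn_trans (ltn_ord j).
  have := h3 (Ordinal jN); rewrite /= ltn_ord /= (rl j) // => /andP[a1 a2].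
  have := h4 (Ordinal jN'); rewrite /= ltn_ord r0 /= (rl j) // (dl (lift ord0 j)) //= => a3.
  have := h5 (Ordinal jN); rewrite /= ltn_ord r0 /= (rl j) // (dl (lift ord_max j)) ?lm //= => a4.
  rewrite /lo /hi; move: a1 a2 a3 a4.
  case: (_ =P 1%N) => _; case: (_ =P 0%N) => _ /=; lia.
move=> H.
have H' (j : 'I_r) : [/\ rent l j <= (l' j : nat)%:Z - B%:Z,
   (l' j : nat)%:Z - B%:Z <= rent l j.+1,
   rent l j = (l' j : nat)%:Z - B%:Z -> d (lift ord_max j) = 0%N :> nat &
   rent l j.+1 = (l' j : nat)%:Z - B%:Z -> d (lift ord0 j) = 1%N :> nat].
  have := H j; rewrite /lo /hi.
  by case: (_ =P 1%N) => e1; case: (_ =P 0%N) => e0 /= h; split => //; lia.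
apply/andP; split; first (apply/andP; split).
- by apply/forallP => j; apply/implyP => rj; rewrite ffunE insubF // ltnNge rj.
- apply/forallP => j; apply/implyP => jr.
  have jr' : (j < r)%N by rewrite ltnW.
  rewrite (rl (Ordinal jr')) // (rl (Ordinal jr)) //.
  case: (H' (Ordinal jr')) => _ /= a _ b; case: (H' (Ordinal jr)) => /= c _ e _.
  rewrite lt_neqAle (le_trans a c) andbT; apply/eqP => ee.
  have e1 : rent l j.+1 = (l' (Ordinal jr') : nat)%:Z - B%:Z by lia.
  have e2 : rent l j.+1 = (l' (Ordinal jr) : nat)%:Z - B%:Z by lia.
  move: (b e1) (e e2); rewrite (_ : lift ord0 _ = lift ord_max (Ordinal jr)); first by move=> ->.
  by apply: val_inj; rewrite /= /bump leq0n leqNgt jr.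
apply/and5P; split; apply/forallP => j.
- by apply/implyP => rj; rewrite (implyP (v1 j)) // ffunE insubF // ltnNge rj.
- exact: v2.
- apply/implyP => jr; rewrite (rl (Ordinal jr)) //.
  by case: (H' (Ordinal jr)) => /= -> ->.
- apply/implyP => /and4P[r0 j0 jr /eqP].
  have jr' : (j.-1 < r)%N by lia.
  rewrite (rl (Ordinal jr')) //.
  case: (H' (Ordinal jr')) => _ _ _ /=; rewrite prednK // => h /h.
  by rewrite (dl (lift ord0 (Ordinal jr'))) /= ?/bump ?leq0n ?add1n ?prednK // => ->.
apply/implyP => /and3P[r0 jr /eqP].
rewrite (rl (Ordinal jr)) //.
case: (H' (Ordinal jr)) => _ _ h _ /h.
by rewrite (dl (lift ord_max (Ordinal jr))) ?lm // => ->.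
Qed.

Lemma prod_lt_ord (R : Type) (idx : R) (op : Monoid.com_law idx) (r n : nat) (f : nat -> R) :
  (r <= n)%N -> \big[op/idx]_(j < n | (j < r)%N) f j = \big[op/idx]_(j < r) f j.
Proof. by move=> le; rewrite (big_ord_widen _ (fun i => f i) le). Qed.

Lemma row_step (x : nat -> K) (r : nat) (l : L) (e : D) :
  (r < N)%N -> x r != 0 -> (forall i, (i < r)%N -> x i != 0) -> (forall i, (i < r)%N -> x i != x r) ->
  (\prod_(i < r) (x r - x i)) * (\sum_(d : D) \sum_(l' : L) (valid r l')%:R * alt u v w x r (rent l') *
     rstep u v w x r (l', e) (l, d)) = (valid r.+1 l)%:R * alt u v w x r.+1 (rent l).
Proof.
move=> rN xr x0 xd; have [vl|nvl] := boolP (valid r.+1 l); last first.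
  rewrite mul0r [X in _ * X]big1 ?mulr0 // => d _; rewrite big1 // => l' _; rewrite /rstep /=.
  rewrite (_ : okrow _ _ _ _ = false) ?mul0r ?mulr0 //.
  by apply: contraNF nvl; apply: okrow_valid.
rewrite mul1r alt_rec // -mulrA; congr (_ * _).
rewrite (@sum_extf _ ord0 _ r.+1) // => [|d nd]; last first.
  rewrite big1 // => l' _; rewrite /rstep /=.
  rewrite (_ : okrow _ _ _ _ = false) ?mul0r ?mulr0 //.
  apply: contraNF nd => /and5P[/forallP h _ _ _ _]; apply/forallP => j; apply/implyP => rj.
  by have /implyP/(_ rj)/andP[] := h j.
rewrite big_distrr; apply: eq_bigr => d _ /=.
rewrite (@sum_extf _ ord0 _ r) ?(ltnW rN) // => [|l' nl]; last first.
  by rewrite /valid (negPf nl) /= !mul0r.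
pose box (j : 'I_r) (t : 'I_(B.*2).+1) := (lo (rent l) d j <= (t : nat)%:Z - B%:Z) &&
                    ((t : nat)%:Z - B%:Z <= hi (rent l) d j).
have dE (j : 'I_r.+1) : extf ord0 N d (widen_ord rN j) = d j by apply: extfE.
have decE : \prod_(j < N | (j <= r)%N) decw u v w (x r) (extf ord0 N d j) =
    \prod_(i < r.+1) decw u v w (x r) (d i).
  pose f (j : nat) := decw u v w (x r) (if (insub j : option 'I_N) is Some j' then extf ord0 N d j' else (ord0 : 'I_3)).
  transitivity (\prod_(j < N | (j < r.+1)%N) f j); first by apply: eq_bigr => j _; rewrite /f valK.
  rewrite (@prod_lt_ord _ _ _ r.+1) //; apply: eq_bigr => j _.
  by rewrite /f (valK (widen_ord rN j) : insub (j : nat) = _) dE.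
have jN (j : 'I_r) : (j < N)%N by apply: ltn_trans (ltn_ord j) rN.
have rE (l' : {ffun 'I_r -> 'I_(B.*2).+1}) (j : 'I_r) : rent (extf ord0 N l') j = (l' j : nat)%:Z - B%:Z.
  by rewrite (rentE _ (Ordinal (jN j))) (@extfE _ _ _ _ _ _ j).
have rs1 : rsum r.+1 l = \sum_(j < r.+1) rent l j by rewrite /rsum prod_lt_ord.
have rs2 (l' : {ffun 'I_r -> 'I_(B.*2).+1}) :
    x r ^ (- rsum r (extf ord0 N l')) = \prod_(j < r) x r ^ (- ((l' j : nat)%:Z - B%:Z)).
  rewrite /rsum prod_lt_ord ?(ltnW rN) // -sumrN.
  elim/big_rec2: _ => [|j a b _ <-]; first by rewrite expr0z.
  by rewrite rE expfzDr.
transitivity (\sum_(l' : {ffun 'I_r -> 'I_(B.*2).+1}) \sum_(s : 'S_r)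
  ((\prod_(i < r.+1) decw u v w (x r) (d i)) * x r ^ (\sum_(j < r.+1) rent l j) *
    ((-1) ^+ s * pairw u v w (fun j => x (s j)))) *
   \prod_(j < r) (if box j (l' j) then x (s j) ^+ j * (x (s j) / x r) ^ ((l' j : nat)%:Z - B%:Z) else 0)).
  apply: eq_bigr => l' _; rewrite /rstep /=.
  have := okrow_box l' d rN vl; rewrite -/box => okE.
  have [/forallP bx|nb] := boolP [forall j, box j (l' j)]; last first.
    rewrite [RHS]big1 => [|s _].
      have/negP nok : ~~ (valid r (extf ord0 N l') && okrow r (extf ord0 N l') l (extf ord0 N d)) by rewrite okE.
      have [ok1|] := boolP (valid r _); last by rewrite !mul0r.
      rewrite (_ : okrow _ _ _ _ = false) ?mul0r ?mulr0 //.
      by apply/negP => ok2; apply: nok; rewrite ok1 ok2.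
    move: nb; rewrite negb_forall => /existsP[j bj].
    by rewrite (bigD1 j) //= (negPf bj) mul0r mulr0.
  have /andP[-> ->] : valid r (extf ord0 N l') && okrow r (extf ord0 N l') l (extf ord0 N d).
    by rewrite okE; apply/forallP.
  rewrite !mul1r decE rs1 expfzDr // rs2 /alt big_distrl; apply: eq_bigr => s _ /=.
  have -> : \prod_(j < r) (if box j (l' j)
      then x (s j) ^+ j * (x (s j) / x r) ^ ((l' j : nat)%:Z - B%:Z) else 0) =
    (\prod_(j < r) x (s j) ^ (rent (extf ord0 N l') j + j%:Z)) *
    \prod_(j < r) x r ^ (- ((l' j : nat)%:Z - B%:Z)).
    rewrite -big_split; apply: eq_bigr => j _ /=.
    rewrite bx rE; move: (_ - B%:Z) => e0; rewrite expfzDr ?x0 // -exprnP expfzMl -invr_expz -expfV.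
    by rewrite mulrCA mulrA.
  have alg (a b c f g h n : K) : a * (b * f) * (c * (h * n)) = c * h * (a * f) * (b * n).
    by ring.
  exact: alg.
rewrite exchange_big /= big_distrr /= big_distrr /=; apply: eq_bigr => s _.
rewrite -big_distrr /= -(bigA_distr_bigA (fun j t => if box j t then
   x (s j) ^+ j * (x (s j) / x r) ^ ((t : nat)%:Z - B%:Z) else 0)).
have -> : \prod_(j < r) \sum_(t : 'I_(B.*2).+1) (if box j t then
     x (s j) ^+ j * (x (s j) / x r) ^ ((t : nat)%:Z - B%:Z) else 0) =
   \prod_(j < r) (x (s j) ^+ j * geo (x (s j) / x r) (lo (rent l) d j) (hi (rent l) d j)).
  apply: eq_bigr => j _; rewrite -big_mkcond -big_distrr /=; congr (_ * _).
  have ltj : (j < N)%N := jN j.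
  have ltj' : (j.+1 < N)%N by exact: (leq_ltn_trans (ltn_ord j) rN).
  have := implyP (forallP (andP vl).2 (Ordinal ltj)); rewrite /= ltnS ltn_ord => /(_ isT) lt_l.
  have b1 := rentE l (Ordinal ltj); have b2 := rentE l (Ordinal ltj').
  have b3 := ltn_ord (l (Ordinal ltj')).
  rewrite /= in b1 b2.
  apply: sum_geo; rewrite /lo /hi.
  - by apply: mulf_neq0; rewrite ?invr_eq0 //; apply: x0.
  - by rewrite -subr_eq0 -(divff xr) -mulrBl mulf_neq0 ?invr_eq0 // subr_eq0 xd.
  - by lia.
  - by case: (_ =P 1%N) => e1; case: (_ =P 0%N) => e0 /=; lia.
  by case: (_ =P 1%N) => e1 /=; lia.
have alg (a b c f g : K) : a * b * (c * f) * g = b * (a * (c * (g * f))) by ring.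
exact: alg.
Qed.
End Step.

Lemma eq_alt (K : fieldType) (u v w : K) (x : nat -> K) (m : nat) (k k' : nat -> int) :
  (forall j, (j < m)%N -> k j = k' j) -> alt u v w x m k = alt u v w x m k'.
Proof.
by move=> e; apply: eq_bigr => s _; congr (_ * (_ * _)); apply: eq_bigr => j _; rewrite e.
Qed.

Lemma alt0 (K : fieldType) (u v w : K) (x : nat -> K) (k : nat -> int) : alt u v w x 0 k = 1.
Proof.
have p1 (s : 'S_0) : s = 1%g by apply/permP => -[].
rewrite /alt (bigD1 1%g) //= [X in _ + X]big1 ?addr0 => [|s /negP[]]; last exact/eqP/p1.
by rewrite odd_perm1 /pairw !big_ord0 !mul1r.
Qed.

Section AmtAlt.
Variables (K : fieldType) (u v w : K) (m : nat).
Local Notation N := m.+1.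

Lemma chain_alt (B : nat) (x : nat -> K) (r : nat) (l : {ffun 'I_N -> 'I_(B.*2).+1}) :
  (r < N)%N -> (forall i, (i < N)%N -> x i != 0) ->
  (forall i j, (i < j < N)%N -> x i != x j) ->
  vdm x r.+1 * \sum_d chain (zrow m B) (rstep u v w x) r (l, d) =
  (valid r.+1 l)%:R * alt u v w x r.+1 (rent l).
Proof.
move=> rN x0 xd; elim: r rN l => [|r IH] rN l.
  rewrite -(@row_step _ u v w m B x 0 l (zrow m B).2) // ?x0 // vdmS {1}/vdm !big_ord0 !mul1r.
  apply: eq_bigr => d _; rewrite (bigD1 (zrow m B).1) //= [X in _ + X]big1 ?addr0 => [|l' ne].
    rewrite alt0 (_ : valid _ _ = true) ?mul1r //.
    by apply/andP; split; apply/forallP => j; rewrite ?ffunE ?eqxx.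
  rewrite (_ : valid _ _ = false) ?mul0r //; apply: contraNF ne => /andP[/forallP h _].
  by apply/eqP/ffunP => j; rewrite ffunE; apply/eqP/h.
rewrite -(@row_step _ u v w m B x r.+1 l (zrow m B).2) // ?x0 //; last first.
- by move=> i ir; rewrite xd // ir.
- by move=> i ir; apply/x0/(ltn_trans ir).
rewrite vdmS -mulrA mulrCA; congr (_ * _).
rewrite big_distrr; apply: eq_bigr => d _ /=.
transitivity (vdm x r.+1 * \sum_l' \sum_d' chain (zrow m B) (rstep u v w x) r (l', d') *
   rstep u v w x r.+1 (l', (zrow m B).2) (l, d)).
  by rewrite pair_bigA /=; congr (_ * _); apply: eq_bigr => -[l' d'] _.
rewrite big_distrr; apply: eq_bigr => l' _ /=.
by rewrite -big_distrl /= mulrA IH // ltnW.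
Qed.

Definition natfun (k : 'I_N -> int) (j : nat) : int := if oord N j is Some i then k i else 0.

Lemma natfunE k (i : 'I_N) : natfun k i = k i.
Proof. by rewrite /natfun oordE. Qed.

Theorem amt_gf_alt (X : 'I_N -> K) (k : 'I_N -> int) :
  (forall i, X i != 0) -> injective X -> (forall i j : 'I_N, (i < j)%N -> k i < k j) ->
  vdm (Xat X) N * amt_gf u v w X k = alt u v w (Xat X) N (natfun k).
Proof.
move=> X0 Xi kk; rewrite amt_gf_chain //.
have x0 := Xat_neq0 X0; have xd := Xat_neq Xi.
set B := bnd k.
have kB (j : 'I_N) : (`|k j| <= B)%N by rewrite /B /bnd (bigD1 j) //= leq_addr.
pose l0 : {ffun 'I_N -> 'I_(B.*2).+1} := [ffun j => inord (absz (k j + B%:Z)%R)].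
have l0E (j : 'I_N) : rent l0 j = k j.
  have bj := kB j.
  rewrite rentE ffunE inordK; lia.
transitivity (vdm (Xat X) N * \sum_d chain (zrow m B) (rstep u v w (Xat X)) m (l0, d)).
  congr (_ * _).
  transitivity (\sum_(l : {ffun 'I_N -> 'I_(B.*2).+1}) \sum_(d : {ffun 'I_N -> 'I_3}) [forall j : 'I_N, rent l j == k j]%:R *
      chain (zrow m B) (rstep u v w (Xat X)) m (l, d)).
    by rewrite pair_bigA; apply: eq_bigr => -[].
  rewrite (bigD1 l0) //= [X in _ + X]big1 ?addr0 => [|l ne].
    apply: eq_bigr => d _; rewrite (_ : [forall _, _] = true) ?mul1r //.
    by apply/forallP => j; rewrite l0E.
  rewrite big1 // => d _; rewrite (_ : [forall _, _] = false) ?mul0r //.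
  apply: contraNF ne => /forallP h; apply/eqP/ffunP => j; apply: val_inj.
  have := h j; rewrite -l0E !rentE => /eqP /=; lia.
rewrite chain_alt // (_ : valid _ _ = true); last first.
  apply/andP; split; apply/forallP => j; apply/implyP => jN.
    by have := ltn_ord j; rewrite ltnNge jN.
  by rewrite -[j.+1]/(val (Ordinal jN)) !l0E kk.
rewrite mul1r; apply: eq_alt => j jN.
by rewrite -[j]/(val (Ordinal jN)) l0E natfunE.
Qed.
End AmtAlt.

(** * The bialternant formula for tableaux *)

Section Alternant.
Variables (K : fieldType) (x : nat -> K).

Definition alternant (m : nat) (k : nat -> int) : K :=
  \sum_(s : 'S_m) (-1) ^+ s * \prod_(j < m) x (s j) ^ k j.

Lemma pairw010 (m : nat) (z : 'I_m -> K) : pairw 0 1 0 z = \prod_(q < m) (z q) ^- q.+1.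
Proof.
rewrite /pairw (exchange_big_dep predT) //=; apply: eq_bigr => q _.
under eq_bigr => p _ do rewrite /wt2 !mul0r add0r addr0 mul1r.
rewrite prodr_const -exprVn; congr (_ ^+ _).
rewrite -sum1_card (eq_bigl (fun p : 'I_m => (p < q.+1)%N)) //.
by rewrite -(big_ord_widen _ (fun=> 1%N)) // sum1_card card_ord.
Qed.

Lemma alt010 (m : nat) (k : nat -> int) : (forall i, (i < m)%N -> x i != 0) ->
  alt 0 1 0 x m k = alternant m (fun j => k j - 1).
Proof.
move=> x0; apply: eq_bigr => s _; rewrite pairw010; congr (_ * _).
rewrite -big_split; apply: eq_bigr => j _ /=.
rewrite -[_ ^- _]/((x (s j) ^ (j.+1 : int))^-1) invr_expz -expfzDr ?x0 //.
by congr (_ ^ _); lia.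
Qed.

Lemma alternant_rec (m : nat) (k : nat -> int) :
  x m != 0 -> (forall i, (i < m)%N -> x i != 0) -> (forall i, (i < m)%N -> x i != x m) ->
  alternant m.+1 k = (\prod_(i < m) (x m - x i)) * x m ^ (\sum_(j < m.+1) k j - m%:Z) *
    \sum_(s : 'S_m) (-1) ^+ s * \prod_(j < m) geo (x (s j) / x m) (k j) (k j.+1 - 1).
Proof.
move=> t0 x0 xd.
transitivity (alt 0 1 0 x m.+1 (fun j => k j + 1)).
  rewrite alt010 => [|i]; last by rewrite ltnS leq_eqVlt => /predU1P[->|/x0].
  by apply: eq_bigr => s _; congr (_ * _); apply: eq_bigr => j _; rewrite addrK.
rewrite alt_rec // -!mulrA; congr (_ * _).
rewrite (bigD1 [ffun=> ord0]) //= [X in _ + X]big1 ?addr0 => [|d dn]; last first.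
  have [i di] : exists i, d i != ord0.
    apply/existsP; rewrite -negb_forall; apply: contra dn => /forallP h.
    by apply/eqP/ffunP => i; rewrite ffunE; apply/eqP/h.
  rewrite [X in X * _](bigD1 i) //=; move: di.
  by case: (d i) => -[|[|[|//]]] //= ? _; rewrite ?mul0r.
have -> : \prod_(i < m.+1) decw 0 1 0 (x m) (([ffun=> ord0] : {ffun 'I_m.+1 -> 'I_3}) i) =
   \prod_(i < m.+1) (x m)^-1 by apply: eq_bigr => i _; rewrite ffunE /= mul1r.
rewrite prodr_const card_ord mulrA.
have -> : x m ^ (\sum_(j < m.+1) (k j + 1)) * (x m)^-1 ^+ m.+1 =
          x m ^ (\sum_(j < m.+1) k j - m%:Z) * x m ^ m%:Z.
  rewrite -expfzDr // subrK exprVn -[_ ^- _]/((x m ^ (m.+1 : int))^-1) invr_expz -expfzDr //.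
  by congr (_ ^ _); rewrite big_split /= sumr_const card_ord natz addrK.
rewrite -!mulrA; congr (_ * _); rewrite big_distrr; apply: eq_bigr => s _ /=.
rewrite mulrCA pairw010; congr (_ * _).
have -> : x m ^ m%:Z = \prod_(j < m) x m by rewrite prodr_const card_ord.
rewrite -!big_split /=; apply: eq_bigr => j _.
have zt : x (s j) - x m != 0 by rewrite subr_eq0 xd.
have z0 : x (s j) != 0 by apply: x0.
have y0 : x (s j) / x m != 0 by rewrite mulf_neq0 ?invr_eq0.
rewrite /geo /lo /hi !ffunE /= addr0 addrK subrK.
rewrite !expfzDr // expr1z exprS.
set A := _ ^ k j; set C := _ ^ k j.+1; set z := x (s j) in zt z0 *; set t := x m in t0 zt *.
have zj : z ^+ j != 0 by rewrite expf_neq0.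
move: (z ^+ j) zj A C => zz zz0 A C.
by field; rewrite mulN1r t0 zt z0 zz0.
Qed.
End Alternant.

Lemma card_initial (M : nat) (P : pred 'I_M) :
  (forall c c' : 'I_M, (c' <= c)%N -> P c -> P c') ->
  forall c : 'I_M, P c = (c < #|P|)%N.
Proof.
move=> down c.
have [n nM eP] : exists2 n, (n <= M)%N & forall c : 'I_M, P c = (c < n)%N.
  have [/forallP all|] := boolP [forall c, P c].
    by exists M => // c'; rewrite all ltn_ord.
  rewrite negb_forall => /existsP[c0 nc0].
  case: (@arg_minnP _ c0 (fun c => ~~ P c) (fun c => c : nat) nc0) => i ni mi.
  exists i => [|c']; first exact/ltnW.
  apply/idP/idP => [pc|]; last by apply: contraTT; rewrite -leqNgt; apply: mi.
  by rewrite ltnNge; apply: contra ni => le; apply: down pc.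
rewrite eP; congr (_ < _)%N; rewrite (eq_card (B := fun c : 'I_M => (c < n)%N)) //.
by rewrite -sum1_card -(big_ord_widen _ (fun=> 1%N)) // sum1_card card_ord.
Qed.

Section Tableaux.
Variables (n M : nat).
Local Notation Tab := {ffun 'I_n * 'I_M -> 'I_n.+1}.
Local Notation Shape := {ffun 'I_n -> 'I_M.+1}.

Definition ssyt (t : nat) (mu : Shape) (T : Tab) : bool :=
  [&& [forall rc : 'I_n * 'I_M, (rc.2 < mu rc.1)%N == (T rc != ord0)],
      [forall r : 'I_n, forall c : 'I_M, forall c' : 'I_M,
        (c' == c.+1 :> nat) ==> (c' < mu r)%N ==> (T (r, c) <= T (r, c'))%N],
      [forall r : 'I_n, forall r' : 'I_n, forall c : 'I_M,
        (r' == r.+1 :> nat) ==> (c < mu r')%N ==> (T (r, c) < T (r', c))%N] &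
      [forall rc, T rc <= t]%N].

Lemma ssytP (t : nat) (mu : Shape) (T : Tab) : reflect
  [/\ forall (r : 'I_n) (c : 'I_M), (c < mu r)%N = (T (r, c) != ord0),
      forall (r : 'I_n) (c c' : 'I_M), c' = c.+1 :> nat -> (c' < mu r)%N -> (T (r, c) <= T (r, c'))%N,
      forall (r r' : 'I_n) (c : 'I_M), r' = r.+1 :> nat -> (c < mu r')%N -> (T (r, c) < T (r', c))%N &
      forall (r : 'I_n) (c : 'I_M), (T (r, c) <= t)%N] (ssyt t mu T).
Proof.
apply: (iffP and4P) => -[h1 h2 h3 h4]; split.
- by move=> r c; have /eqP := forallP h1 (r, c).
- by move=> r c c' /eqP e; apply/implyP/(implyP (forallP (forallP (forallP h2 r) c) c')).
- by move=> r c c' /eqP e; apply/implyP/(implyP (forallP (forallP (forallP h3 r) c) c')).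
- by move=> r c; exact: (forallP h4 (r, c)).
- by apply/forallP => -[r c]; apply/eqP/h1.
- by apply/forallP => r; apply/forallP => c; apply/forallP => c'; apply/implyP => /eqP e; apply/implyP/h2.
- by apply/forallP => r; apply/forallP => c; apply/forallP => c'; apply/implyP => /eqP e; apply/implyP/h3.
by apply/forallP => -[r c]; apply: h4.
Qed.

Lemma ssyt_row (t : nat) (mu : Shape) (T : Tab) (r : 'I_n) (c c' : 'I_M) :
  ssyt t mu T -> (c <= c')%N -> (c' < mu r)%N -> (T (r, c) <= T (r, c'))%N.
Proof.
case/ssytP => _ h2 _ _ le; have [d] : exists d, c' = (c + d)%N :> nat.
  by exists (c' - c)%N; rewrite subnKC.
elim: d c' {le} => [|d IH] c' e lt.
  by rewrite (_ : c' = c) //; apply: val_inj; rewrite /= e addn0.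
have ltM : (c + d < M)%N by have := ltn_ord c'; lia.
apply: leq_trans (IH (Ordinal ltM) _ _) (h2 _ _ _ _ _) => //=; lia.
Qed.

Definition is_shape (mu : Shape) : Prop :=
  forall r r' : 'I_n, r' = r.+1 :> nat -> (mu r' <= mu r)%N.

Lemma ssyt_gt_row (t : nat) (mu : Shape) (T : Tab) (r : 'I_n) (c : 'I_M) :
  is_shape mu ->
  ssyt t mu T -> (c < mu r)%N -> (r < T (r, c))%N.
Proof.
move=> part /ssytP[h1 _ h3 _]; case: r => r rn.
elim: r rn => [|r IH] rn lt; first by move: lt; rewrite h1 -val_eqE /= lt0n.
have rn' := ltnW rn.
apply: leq_ltn_trans (h3 (Ordinal rn') _ _ _ lt) => //.
by apply: IH; apply: leq_trans lt (part _ _ _).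
Qed.

Definition sh (T : Tab) : Shape := [ffun r => inord #|[pred c | T (r, c) != ord0]|].
(* Removing the largest entry [t] of a tableau ([cut]) and putting it back ([glue]). *)
Definition glue (t : 'I_n.+1) (mu : Shape) (T : Tab) : Tab :=
  [ffun rc => if (T rc == ord0) && (rc.2 < mu rc.1)%N then t else T rc].
Definition cut (t : nat) (T : Tab) : Tab := [ffun rc => if (T rc <= t)%N then T rc else ord0].

Definition interlaced (mu nu : Shape) : bool :=
  [forall r : 'I_n, (nu r <= mu r)%N] &&
  [forall r : 'I_n, forall r' : 'I_n, (r' == r.+1 :> nat) ==> (mu r' <= nu r)%N].

Lemma shE (T : Tab) (r : 'I_n) : sh T r = #|[pred c | T (r, c) != ord0]| :> nat.
Proof. by rewrite ffunE inordK // ltnS -[X in (_ <= X)%N](card_ord M) max_card. Qed.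

Lemma sh_ssyt (t : nat) (mu : Shape) (T : Tab) : ssyt t mu T -> sh T = mu.
Proof.
case/ssytP => h1 _ _ _; apply/ffunP => r; apply: val_inj; rewrite /= shE.
rewrite (eq_card (B := fun c : 'I_M => (c < mu r)%N)) => [|c]; last by rewrite !inE -h1.
by rewrite -sum1_card -(big_ord_widen _ (fun=> 1%N)) ?sum1_card ?card_ord // -ltnS.
Qed.

Lemma glue_cut (t : 'I_n.+1) (t' : nat) (mu : Shape) (T : Tab) : t = t'.+1 :> nat -> ssyt t mu T -> glue t mu (cut t' T) = T.
Proof.
move=> et /ssytP[h1 _ _ h4]; apply/ffunP => -[r c]; rewrite !ffunE /= h1.
have := h4 r c; rewrite et leq_eqVlt ltnS => /orP[/eqP e|->]; last by case: eqP => [->|].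
have nz : T (r, c) != ord0 by rewrite -val_eqE /= e.
by apply: val_inj; rewrite e ltnn eqxx nz /= et.
Qed.

Lemma cut_glue_ssyt (t : 'I_n.+1) (t' : nat) (mu nu : Shape) (T : Tab) :
  t = t'.+1 :> nat -> is_shape mu ->
  ssyt t mu (glue t mu T) && ((sh (cut t' (glue t mu T)), cut t' (glue t mu T)) == (nu, T)) =
  interlaced mu nu && ssyt t' nu T.
Proof.
move=> et part; have t0 : t != ord0 by rewrite -val_eqE /= et.
apply/idP/idP.
  case/andP => sG /eqP[]; move: (sG) => /ssytP[h1 h2 h3 h4] eS eT; rewrite eT in eS.
  have Tle r c : (T (r, c) <= t')%N by rewrite -eT ffunE; case: ifP.
  have GE r c : T (r, c) = if (glue t mu T (r, c) <= t')%N then glue t mu T (r, c) else ord0.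
    by rewrite -{1}eT ffunE.
  have nuE r (c : 'I_M) : (c < nu r)%N = (T (r, c) != ord0).
    rewrite -eS shE -(@card_initial _ [pred c | T (r, c) != ord0]) // => a b le /=.
    rewrite [T (r, a)]GE [T (r, b)]GE; case: ifP => [lea na|]; last by rewrite eqxx.
    have la : (a < mu r)%N by rewrite h1.
    rewrite (leq_trans (ssyt_row sG le la) lea) -h1; exact: leq_ltn_trans la.
  have nuT r (c : 'I_M) : (c < nu r)%N -> glue t mu T (r, c) = T (r, c).
    by rewrite nuE ffunE => /negPf ->.
  have lemu r (c : 'I_M) : (c < nu r)%N -> (c < mu r)%N.
    by move=> lt; rewrite h1 nuT // -nuE.
  apply/andP; split; first (apply/andP; split; apply/forallP => r).
  - rewrite leqNgt; apply/negP => lt.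
    have ltM : (mu r < M)%N by apply: leq_trans lt _; rewrite -ltnS.
    by have := lemu r (Ordinal ltM) lt; rewrite /= ltnn.
  - apply/forallP => r'; apply/implyP => /eqP e; rewrite leqNgt; apply/negP => lt.
    have ltM : (nu r < M)%N by apply: leq_trans lt _; rewrite -ltnS.
    have := h3 r r' (Ordinal ltM) e lt; have := h4 r' (Ordinal ltM); rewrite et => a b.
    have le : (glue t mu T (r, Ordinal ltM) <= t')%N by rewrite -ltnS (leq_trans b).
    have : ((Ordinal ltM : nat) < nu r)%N.
      by rewrite nuE GE le -h1 (leq_trans lt) // part.
    by rewrite /= ltnn.
  apply/ssytP; split => //.
  - move=> r c c' e lt; rewrite -!nuT //; last by apply: ltn_trans lt; rewrite e.
    by apply: h2 e (lemu _ _ lt).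
  move=> r r' c e lt.
  have := h3 r r' c e (lemu _ _ lt); rewrite (nuT r') // => lt'.
  have le : (glue t mu T (r, c) <= t')%N by apply: leq_trans (ltnW lt') (Tle _ _).
  by rewrite (GE r) le.
case/andP => /andP[/forallP i1 /forallP i2] sT; move: (sT) => /ssytP[h1 h2 h3 h4].
have i2' (r r' : 'I_n) : r' = r.+1 :> nat -> (mu r' <= nu r)%N.
  by move=> /eqP; apply/implyP/(forallP (i2 r)).
have GE r (c : 'I_M) : glue t mu T (r, c) = if (c < nu r)%N then T (r, c) else
    if (c < mu r)%N then t else ord0.
  rewrite ffunE /=; have := h1 r c; case: ltnP => _ /esym e; rewrite ?(negPf e) //.
  by move/negbFE/eqP: e => ->; rewrite eqxx.
have cutE : cut t' (glue t mu T) = T.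
  apply/ffunP => -[r c]; rewrite ffunE GE.
  have := h1 r c; case: ltnP => _ /esym; first by rewrite h4.
  by move/negbFE/eqP => ->; case: ifP; case: ifP; rewrite // et ltnn.
rewrite cutE (sh_ssyt sT) eqxx andbT; apply/ssytP; split.
- move=> r c; rewrite GE; case: (ltnP c (nu r)) => [lt|_]; last by case: (ltnP c (mu r)) => _; rewrite ?t0 ?eqxx.
  by rewrite -h1 lt (leq_trans lt (i1 r)).
- move=> r c c' e lt; rewrite !GE; case: (ltnP c' (nu r)) => lt'.
    by rewrite ifT; [apply: h2 e lt' | apply: ltn_trans lt'; rewrite e].
  rewrite lt; case: ifP => _; first by apply: leq_trans (h4 _ _) _; rewrite et.
  by case: ifP.
- move=> r r' c e lt; rewrite !GE (leq_trans lt (i2' _ _ e)).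
  case: (ltnP c (nu r')) => lt'; first exact: h3 e lt'.
  by rewrite lt et ltnS.
move=> r c; rewrite GE; case: ifP => _; first by apply: leq_trans (h4 _ _) _; rewrite et.
by case: ifP.
Qed.
End Tableaux.

Section Bialternant.
Variables (K : fieldType) (x : nat -> K) (n M : nat).
Local Notation Tab := {ffun 'I_n * 'I_M -> 'I_n.+1}.
Local Notation Shape := {ffun 'I_n -> 'I_M.+1}.

Definition tabsum (t : nat) (mu : Shape) : K :=
  \sum_(T : Tab | ssyt t mu T) \prod_(rc : 'I_n * 'I_M | (rc.2 < mu rc.1)%N) x (T rc).-1.

Lemma prod_lt_const (y : K) (N a : nat) : (a <= N)%N -> \prod_(c < N | (c < a)%N) y = y ^+ a.
Proof. by move=> le; rewrite (prod_lt_ord _ (fun=> y)) // prodr_const card_ord. Qed.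

Lemma tabsum_rec (t : nat) (mu : Shape) : (t < n)%N -> x t != 0 -> is_shape mu ->
  tabsum t.+1 mu = \sum_(nu : Shape | interlaced mu nu)
    (\prod_(r < n) (x t ^+ mu r / x t ^+ nu r)) * tabsum t nu.
Proof.
move=> tn t0 part; have tn1 : (t.+1 < n.+1)%N by [].
pose tt : 'I_n.+1 := Ordinal tn1.
under [RHS]eq_bigr => nu _ do rewrite /tabsum big_distrr.
rewrite pair_big_dep /= /tabsum.
rewrite (reindex_onto (fun p : Shape * Tab => glue tt mu p.2)
   (fun T => (sh (cut t T), cut t T))) /=; last first.
  by move=> T sT; exact: (@glue_cut n M tt t mu T erefl sT).
have cond (p : Shape * Tab) : ssyt t.+1 mu (glue tt mu p.2) &&
    ((sh (cut t (glue tt mu p.2)), cut t (glue tt mu p.2)) == p) =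
    interlaced mu p.1 && ssyt t p.1 p.2.
  by case: p => nu T; exact: (@cut_glue_ssyt n M tt t mu nu T erefl part).
apply: eq_big => // -[nu T]; rewrite cond /= => /andP[/andP[/forallP i1 _] /ssytP[h1 _ _ _]].
rewrite (bigID (fun rc : 'I_n * 'I_M => (rc.2 < nu rc.1)%N)) /= mulrC; congr (_ * _).
  rewrite (eq_bigr (fun=> x t)); last first.
    move=> [r c] /= /andP[cm]; rewrite ffunE /= h1 negbK => ->.
    by rewrite cm.
  transitivity (\prod_(r < n) \prod_(c < M | (c < mu r)%N && ~~ (c < nu r)%N) x t).
    by rewrite pair_big_dep.
  apply: eq_bigr => r _.
  have lM : (mu r <= M)%N := ltn_ord (mu r); have lN : (nu r <= M)%N := ltn_ord (nu r).
  rewrite -(prod_lt_const (x t) lM) -(prod_lt_const (x t) lN).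
  rewrite [X in _ = X / _](bigID (fun c : 'I_M => (c < nu r)%N)) /=.
  rewrite [X in _ = X * _ / _](eq_bigl (fun c : 'I_M => (c < nu r)%N)) => [|c]; last first.
    by case: (ltnP c (nu r)) => [lt|]; rewrite ?andbF // andbT (leq_trans lt).
  by rewrite [X in _ = X / _]mulrC mulfK // prod_lt_const // expf_neq0.
apply: eq_big => -[r c] /=.
  by case: (ltnP c (nu r)) => [lt|]; rewrite ?andbF // andbT (leq_trans lt).
by case/andP => _; rewrite h1 ffunE /= => /negPf->.
Qed.

Definition part (mu : Shape) (r : nat) : nat := if oord n r is Some r' then mu r' else 0%N.

Lemma partE (mu : Shape) (r : 'I_n) : part mu r = mu r.
Proof. by rewrite /part /oord valK. Qed.

Lemma part_extf t (g : {ffun 'I_t -> 'I_M.+1}) (j : 'I_t) : (t <= n)%N ->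
  part (extf ord0 n g) j = g j.
Proof.
move=> tn; have jn : (j < n)%N by apply: leq_trans (ltn_ord j) tn.
by rewrite -[j : nat]/(val (Ordinal jn)) partE (@extfE _ _ _ _ _ _ j).
Qed.

Lemma alternant0 (k : nat -> int) : alternant x 0 k = 1.
Proof.
have p1 (s : 'S_0) : s = 1%g by apply/permP => -[].
rewrite /alternant (bigD1 1%g) //= [X in _ + X]big1 ?addr0 => [|s /negP[]]; last exact/eqP/p1.
by rewrite odd_perm1 !big_ord0 !mul1r.
Qed.

Lemma tabsum0 (mu : Shape) : (forall r, mu r = ord0) -> tabsum 0 mu = 1.
Proof.
move=> m0; have sh0 T : ssyt 0 mu T = (T == [ffun=> ord0]).
  apply/idP/eqP => [/ssytP[_ _ _ h]|->].
    by apply/ffunP => -[r c]; rewrite ffunE; apply/val_inj/eqP; rewrite /= -leqn0 h.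
  by apply/ssytP; split => [r c|r c c' _|r r' c _|r c]; rewrite ?m0 ?ffunE ?eqxx.
rewrite /tabsum (eq_bigl _ _ sh0) big_pred1_eq big_pred0 // => -[r c].
by rewrite /= m0.
Qed.

Lemma tabsum_eq0 (t : 'I_n) (mu : Shape) : is_shape mu -> (0 < mu t)%N -> tabsum t mu = 0.
Proof.
move=> sm mt; apply: big_pred0 => T; apply/negP => sT.
have M0 : (0 < M)%N by apply: leq_trans mt _; rewrite -ltnS.
have := ssyt_gt_row sm sT (mt : ((Ordinal M0 : nat) < mu t)%N).
by case/ssytP: sT => _ _ _ /(_ t (Ordinal M0)); rewrite ltnNge => ->.
Qed.

Theorem tabsum_alternant (t : nat) (mu : Shape) :
  (t <= n)%N -> (forall i, (i < n)%N -> x i != 0) ->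
  (forall i j, (i < j < n)%N -> x i != x j) ->
  is_shape mu -> (forall r : 'I_n, (t <= r)%N -> mu r = ord0) ->
  vdm x t * tabsum t mu = alternant x t (fun j => (part mu (t.-1 - j) + j)%:Z).
Proof.
move=> tn x0 xd; elim: t tn mu => [|t IH] tn mu sm mu0.
  by rewrite tabsum0 => [|r]; [rewrite /vdm big_ord0 alternant0 mulr1 | exact: mu0].
have tn' := ltnW tn; have t0 := x0 _ tn.
rewrite tabsum_rec // big_mkcond (@sum_extf _ ord0 _ t) //; last first.
  move=> nu; rewrite negb_forall => /existsP[r]; rewrite negb_imply => /andP[tr nur].
  case: ifP => // /andP[/forallP i1 /forallP i2].
  have rt : r = Ordinal tn.
    apply: val_inj => /=; apply/eqP; rewrite eqn_leq tr andbT leqNgt; apply/negP => lt.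
    by move: (i1 r) nur; rewrite mu0 // leqn0 => /eqP e; rewrite -val_eqE /= e.
  rewrite (_ : tabsum t nu = 0) ?mulr0 //; change (tabsum (Ordinal tn) nu = 0).
  apply: tabsum_eq0; last by rewrite -rt lt0n.
  move=> r1 r2 e; apply: leq_trans (i1 _) _.
  by apply: (implyP (forallP (i2 r1) r2)); apply/eqP.
pose k j : int := (part mu (t - j) + j)%:Z.
pose box (j : 'I_t) (a : 'I_M.+1) := (k j <= (a : nat)%:Z + (j : nat)%:Z) &&
   ((a : nat)%:Z + (j : nat)%:Z <= k j.+1 - 1).
have boxE (j : 'I_t) (a : 'I_M.+1) :
    box j a = (part mu (rev_ord j).+1 <= a)%N && (a <= part mu (rev_ord j))%N.
  rewrite /box /k /= subnSK ?ltn_ord //; apply/idP/idP; lia.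
have interE (g : {ffun 'I_t -> 'I_M.+1}) :
    interlaced mu (extf ord0 n g) = [forall j : 'I_t, box j (g (rev_ord j))].
  apply/idP/forallP => [/andP[/forallP i1 /forallP i2] j|H].
    rewrite boxE; set i := rev_ord j.
    have iN : (i < n)%N by apply: leq_trans (ltn_ord i) tn'.
    have iN1 : (i.+1 < n)%N by apply: leq_ltn_trans (ltn_ord i) tn.
    have := i1 (Ordinal iN); rewrite (@extfE _ _ _ _ _ _ i) // -partE => -> /=.
    have /forallP/(_ (Ordinal iN1)) := i2 (Ordinal iN).
    by rewrite (@extfE _ _ _ _ _ _ i) //= eqxx -partE /= andbT.
  have H' (i : 'I_t) : (part mu i.+1 <= g i)%N && (g i <= part mu i)%N.
    by have := H (rev_ord i); rewrite boxE rev_ordK.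
  apply/andP; split; apply/forallP => r.
    have [rt|rt] := ltnP r t; last by rewrite ffunE insubF // ltnNge rt.
    by rewrite (@extfE _ _ _ _ _ _ (Ordinal rt)) // -partE; case/andP: (H' (Ordinal rt)).
  apply/forallP => r'; apply/implyP => /eqP e.
  have [rt|rt] := ltnP r t; last by rewrite mu0 ?e.
  by rewrite (@extfE _ _ _ _ _ _ (Ordinal rt)) // -partE e; case/andP: (H' (Ordinal rt)).
set P := \prod_(p < t) (x t - x p).
set c := x t ^ (\sum_(j < t.+1) k j - t%:Z).
have cE : c = (\prod_(r < n) x t ^+ mu r) * \prod_(j < t) x t ^+ j.
  rewrite /c !prodrXr -exprD exprnP; congr (_ ^ _).
  have -> : \sum_(j < t.+1) k j = (\sum_(j < t.+1) part mu (t - j) + \sum_(j < t.+1) j)%:Z.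
    by rewrite -big_split /=; elim/big_rec2: _ => // j a b _ ->; rewrite /k; lia.
  have -> : (\sum_(j < t.+1) part mu (t - j) = \sum_(r < n) mu r)%N.
    rewrite (reindex_inj rev_ord_inj) /=.
    transitivity (\sum_(r < n | (r < t.+1)%N) part mu r)%N.
      rewrite prod_lt_ord //; apply: eq_bigr => j _; congr (part mu _).
      by rewrite subSS subKn // -ltnS.
    rewrite big_mkcond; apply: eq_bigr => r _; rewrite partE.
    by case: ltnP => // h; rewrite mu0.
  by rewrite big_ord_recr /=; lia.
transitivity (P * \sum_(g : {ffun 'I_t -> 'I_M.+1}) \sum_(s : 'S_t) c * ((-1) ^+ s *
   \prod_(j < t) (if box j (g (rev_ord j)) then
       (x (s j) / x t) ^ ((g (rev_ord j) : nat)%:Z + (j : nat)%:Z) else 0))).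
  rewrite vdmS -/P -mulrA mulrCA; congr (_ * _); rewrite big_distrr; apply: eq_bigr => g _ /=.
  rewrite interE; have [bg|nbg] := boolP [forall j, box j (g (rev_ord j))]; last first.
    rewrite mulr0 big1 // => s _; move: nbg; rewrite negb_forall => /existsP[j /negPf bj].
    by rewrite [X in _ * (_ * X)](bigD1 j) //= bj mul0r !mulr0.
  rewrite mulrCA IH //; last 2 first.
  - move: bg; rewrite -interE => /andP[/forallP i1 /forallP i2] r r' e.
    apply: leq_trans (i1 _) _.
    by apply: (implyP (forallP (i2 r) r')); apply/eqP.
  - by move=> r rt; rewrite ffunE insubF // ltnNge rt.
  rewrite /alternant big_distrr; apply: eq_bigr => s _ /=.
  rewrite mulrCA [RHS]mulrCA; congr (_ * _).
  rewrite cE prodf_div mulrAC -!mulrA; congr (_ * _).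
  have -> : (\prod_(r < n) x t ^+ extf ord0 n g r) = \prod_(j < t) x t ^+ g (rev_ord j).
    rewrite [RHS](reindex_inj rev_ord_inj) /=.
    transitivity (\prod_(r < n | (r < t)%N) x t ^+ part (extf ord0 n g) r).
      rewrite [in RHS]big_mkcond; apply: eq_bigr => r _; rewrite partE.
      by case: ltnP => // h; rewrite ffunE insubF // ltnNge h.
    rewrite (prod_lt_ord _ (fun r => x t ^+ part (extf ord0 n g) r)) //; apply: eq_bigr => j _.
    by rewrite part_extf // rev_ordK.
  rewrite -prodfV -!big_split /=; apply: eq_bigr => j _.
  rewrite (forallP bg) expfzMl -expfV -!exprnP.
  rewrite (_ : (t.-1 - j)%N = rev_ord j) ?part_extf //=; last by lia.
  by rewrite mulrCA; congr (_ * _); rewrite exprD invfM mulrCA mulfV ?mulr1 // expf_neq0.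
rewrite alternant_rec // => [|i it|i it]; last 2 first.
- exact/x0/(ltn_trans it).
- by rewrite xd // it.
rewrite -/P -/c -mulrA; congr (_ * _).
rewrite (reindex_onto (fun g : {ffun 'I_t -> 'I_M.+1} => [ffun j => g (rev_ord j)])
  (fun g : {ffun 'I_t -> 'I_M.+1} => [ffun j => g (rev_ord j)])) /=; last first.
  by move=> g _; apply/ffunP => j; rewrite !ffunE rev_ordK.
rewrite (eq_bigl predT) => [|g]; last by apply/eqP/ffunP => j; rewrite !ffunE rev_ordK.
rewrite exchange_big /= big_distrr; apply: eq_bigr => s _ /=.
rewrite -big_distrr -big_distrr /=; congr (_ * (_ * _)).
under eq_bigr => g _ do under eq_bigr => j _ do rewrite ffunE rev_ordK.
rewrite -(bigA_distr_bigA (fun j a => if box j a then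
    (x (s j) / x t) ^ ((a : nat)%:Z + (j : nat)%:Z) else 0)).
apply: eq_bigr => j _; rewrite -big_mkcond /=.
have jn : (t - j < n)%N by apply: leq_ltn_trans tn; exact: leq_subr.
have jn' : (t - j.+1 < n)%N by apply: leq_ltn_trans tn; exact: leq_subr.
have le : (part mu (t - j) <= part mu (t - j.+1))%N.
  rewrite -[(t - j)%N]/(val (Ordinal jn)) -[(t - j.+1)%N]/(val (Ordinal jn')) !partE.
  by apply: sm => /=; have := ltn_ord j; lia.
have leM : (part mu (t - j.+1) <= M)%N.
  by rewrite -[(t - j.+1)%N]/(val (Ordinal jn')) partE -ltnS.
apply: sum_geo; rewrite /k.
- by apply: mulf_neq0; rewrite ?invr_eq0 //; apply/x0/(ltn_trans _ tn).
- rewrite -subr_eq0 -(divff t0) -mulrBl mulf_neq0 ?invr_eq0 // subr_eq0 xd //.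
  by rewrite ltn_ord.
- by lia.
- by lia.
by lia.
Qed.
End Bialternant.

Section AlternantSym.
Variables (K : fieldType) (x : nat -> K) (n : nat).
Implicit Types (k : nat -> int).

Lemma eq_alternant k k' : (forall j : 'I_n, k j = k' j) -> alternant x n k = alternant x n k'.
Proof.
by move=> e; apply: eq_bigr => s _; congr (_ * _); apply: eq_bigr => j _; rewrite e.
Qed.

Lemma alternant_eq0 k (i1 i2 : 'I_n) : i1 != i2 -> k i1 = k i2 -> alternant x n k = 0.
Proof.
move=> ne e; apply: (sum_sign_tperm ne) => s.
rewrite (reindex_perm (tperm i1 i2)) /=; apply: eq_bigr => j _.
by rewrite permM tpermK; case: tpermP => // ->; rewrite e.
Qed.

Lemma alternant_perm k k' (p : 'S_n) : (forall j : 'I_n, k' j = k (p j)) ->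
  alternant x n k' = (-1) ^+ p * alternant x n k.
Proof.
move=> e; rewrite /alternant (reindex_inj (mulgI p)) big_distrr; apply: eq_bigr => s _ /=.
rewrite odd_permM signr_addb -mulrA; congr (_ * (_ * _)).
rewrite [RHS](reindex_perm p) /=; apply: eq_bigr => j _.
by rewrite permM e.
Qed.

Lemma alternant_shift k (p : nat) : (forall i, (i < n)%N -> x i != 0) ->
  alternant x n (fun j => k j + p%:Z) = (\prod_(i < n) x i ^+ p) * alternant x n k.
Proof.
move=> x0; rewrite /alternant big_distrr; apply: eq_bigr => s _ /=.
rewrite mulrCA; congr (_ * _); rewrite [X in _ = X * _](reindex_perm s) -big_split; apply: eq_bigr => j _ /=.
by rewrite expfzDr ?x0 // mulrC.
Qed.
End AlternantSym.

Section Sorting.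
Variables (n : nat) (f : 'I_n -> int).

Lemma exists_sorting_perm : injective f ->
  exists s : 'S_n, forall i j : 'I_n, (i < j)%N -> f (s j) < f (s i).
Proof.
move=> fi; pose rk a := #|[pred b | f a < f b]|.
have rkn a : (rk a < n)%N.
  rewrite -[X in (_ < X)%N](card_ord n); apply: proper_card; apply/properP; split=> //.
    by apply/subsetP.
  by exists a; rewrite // inE ltxx.
have rk_le a b : f a <= f b -> (rk b <= rk a)%N.
  by move=> le; apply: subset_leq_card; apply/subsetP => c; rewrite !inE; apply: le_lt_trans.
have rk_lt a b : f a < f b -> (rk b < rk a)%N.
  move=> lt; apply: proper_card; apply/properP; split.
    by apply/subsetP => c; rewrite !inE; apply: lt_trans.
  by exists b; rewrite inE ?ltxx.
have rki : injective (fun a => Ordinal (rkn a)).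
  move=> a b /(congr1 val) /= e; apply: fi; apply/eqP; case: ltgtP => // /rk_lt.
    by rewrite e ltnn.
  by rewrite e ltnn.
exists ((perm rki)^-1)%g => i j ij; rewrite ltNge; apply/negP => /rk_le.
have rE (a : 'I_n) : rk (((perm rki)^-1)%g a) = a :> nat.
  by have /(congr1 val) := permKV (perm rki) a; rewrite permE.
by rewrite !rE leqNgt ij.
Qed.

Lemma decreasing_gap (i j : 'I_n) (d : nat) :
  (forall i j : 'I_n, (i < j)%N -> f j < f i) -> j = (i + d)%N :> nat -> f j + d%:Z <= f i.
Proof.
move=> dec; elim: d j => [|d IH] j e.
  by rewrite (_ : j = i) ?addr0 //; apply: val_inj; rewrite /= e addn0.
have lt : (i + d < n)%N by have := ltn_ord j; lia.
have := IH (Ordinal lt) erefl; have : f j < f (Ordinal lt) by apply: dec; rewrite /= e addnS.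
by lia.
Qed.
End Sorting.

Section Schur.
Variables (K : fieldType) (m : nat) (X : 'I_m.+1 -> K).
Local Notation n := m.+1.
Hypotheses (X0 : forall i, X i != 0) (Xi : injective X).
Local Notation x := (Xat X).

Let x0 := Xat_neq0 X0.
Let xd := Xat_neq Xi.

Lemma schur_alternant (mu : seq nat) :
  (forall r r' : 'I_n, r' = r.+1 :> nat -> (nth 0 mu r' <= nth 0 mu r)%N) ->
  vdm x n * schur X mu = alternant x n (fun j => (nth 0 mu (m - j) + j)%:Z).
Proof.
move=> part_mu; set M := sumn mu.
have leM r : (nth 0 mu r < M.+1)%N.
  rewrite ltnS /M; elim: (mu) r => [|a s IH] [|r] //=; first by rewrite leq_addr.
  by rewrite (leq_trans (IH r)) // leq_addl.
pose nu : {ffun 'I_n -> 'I_M.+1} := [ffun r : 'I_n => inord (nth 0 mu r)].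
have nuE r : nu r = nth 0 mu r :> nat by rewrite ffunE inordK.
have tabE (T : {ffun 'I_n * 'I_M -> 'I_n.+1}) (r : 'I_n) (c : 'I_M) : tab_ent T r c = T (r, c).
  by rewrite /tab_ent /oord !valK.
have -> : schur X mu = tabsum x n nu.
  apply: eq_big => [T|T _]; last by apply: eq_bigl => rc; rewrite nuE.
  apply/idP/idP.
    case/and3P => /forallP h1 /forallP h2 /forallP h3; apply/ssytP; split.
    - by move=> r c; rewrite nuE; apply/eqP: (h1 (r, c)).
    - move=> r c c' e; rewrite nuE e => lt.
      by have /forallP/(_ c)/implyP/(_ lt) := h2 r; rewrite -e !tabE.
    - move=> r r' c e; rewrite nuE e => lt.
      have rn : (r.+1 < n)%N by rewrite -e.
      by have /forallP/(_ c)/implyP := h3 r; rewrite rn lt => /(_ isT); rewrite -e !tabE.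
    by move=> r c; rewrite -ltnS.
  case/ssytP => h1 h2 h3 _; apply/and3P; split.
  - by apply/forallP => -[r c] /=; rewrite -nuE h1.
  - apply/forallP => r; apply/forallP => c; apply/implyP => lt.
    have cM : (c.+1 < M)%N by apply: leq_trans lt _; rewrite -ltnS.
    by rewrite -[c.+1]/(val (Ordinal cM)) !tabE; apply: h2; rewrite // nuE.
  apply/forallP => r; apply/forallP => c; apply/implyP => /andP[rn lt].
  by rewrite -[r.+1]/(val (Ordinal rn)) !tabE; apply: h3; rewrite // nuE.
rewrite tabsum_alternant //; last first.
- by move=> r; rewrite leqNgt ltn_ord.
- by move=> r r' e; rewrite !nuE part_mu.
apply: eq_alternant => j; congr (_ + _)%:Z.
have lt : (m - j < n)%N by rewrite ltnS leq_subr.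
by rewrite -[(m - j)%N]/(val (Ordinal lt)) partE nuE.
Qed.

Theorem schur_rev_alternant (l : 'I_n -> int) :
  vdm x n * schur_rev X l = alternant x n (fun j => natfun l j + j%:Z).
Proof.
rewrite /schur_rev /ext_schur; set lam := fun i => l (rev_ord i).
pose k j := natfun l j + j%:Z; pose f (i : 'I_n) := lam i - i%:Z.
have kE (i : 'I_n) : k (rev_ord i) = f i + m%:Z.
  by rewrite /k natfunE /f /lam /=; have := ltn_ord i; lia.
case: ifP => [/existsP[i /existsP[j /andP[ij /eqP e]]]|/negbT dist].
  rewrite mulr0 (@alternant_eq0 _ _ _ _ (rev_ord i) (rev_ord j)) //.
    by rewrite (inj_eq rev_ord_inj) -val_eqE /= ltn_eqF.
  by have := kE i; have := kE j; rewrite /k /f => -> ->; rewrite e.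
have fi : injective f.
  have nd (i j : 'I_n) : (i < j)%N -> f i != f j.
    move=> ij; apply: contra dist => e; apply/existsP; exists i; apply/existsP; exists j.
    by rewrite ij.
  move=> i j e; apply: val_inj; case: (ltngtP i j) => // /nd; rewrite e eqxx.
  - by [].
  - by [].
case: pickP => [s /forallP sP|none]; last first.
  have [s sP] := exists_sorting_perm fi.
  have /negP[] := negbT (none s).
  by apply/forallP => i; apply/forallP => j; apply/implyP/sP.
have {}sP (i j : 'I_n) : (i < j)%N -> f (s j) < f (s i) by apply/implyP/(forallP (sP i)).
set p := (\sum_(i < n) `|lam i|)%N; set mu := map _ _.
have lamp i : - p%:Z <= lam i.
  have : (`|lam i| <= p)%N by rewrite /p (bigD1 i) //= leq_addr.
  by lia.
have gap := @decreasing_gap n (fun i => f (s i)) _ _ _ sP.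
have pos (i : 'I_n) : 0 <= lam (s i) + i%:Z - (s i)%:Z + p%:Z.
  have le : (i <= m)%N by rewrite -ltnS.
  have := gap i ord_max (m - i)%N; rewrite /= subnKC // => /(_ erefl).
  have := lamp (s ord_max); have := ltn_ord (s ord_max); rewrite /f; lia.
have muE (i : 'I_n) : (nth 0%N mu i)%:Z = lam (s i) + i%:Z - (s i)%:Z + p%:Z.
  by rewrite /mu (nth_map i) ?size_enum_ord // nth_ord_enum gez0_abs ?pos.
rewrite mulrAC mulrCA schur_alternant; last first.
  move=> r r' e; have := muE r; have := muE r'; have := gap r r' 1%N.
  by rewrite addn1 => /(_ e); rewrite /f; lia.
pose rp := perm (@rev_ord_inj n).
rewrite (@eq_alternant _ _ _ _ (fun j => (if insub j is Some j' then k ((rp * s * rp)%g j') else 0) + p%:Z)); last first.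
  move=> j; rewrite valK !permM !permE kE PoszD.
  rewrite (_ : (m - j)%N = rev_ord j) ?subSS // muE /f /=; have := ltn_ord j; move: (lam _) (nat_of_ord (s _)) => a b; lia.
rewrite alternant_shift // (@alternant_perm _ _ _ k _ (rp * s * rp)%g); last first.
  by move=> j; rewrite valK.
rewrite !odd_permM addbC addbA addbb addFb.
have -> : \prod_(i < n) x i ^+ p = (\prod_(i < n) X i ^- p)^-1.
  by rewrite -prodfV; apply: eq_bigr => i _; rewrite invrK /Xat oordE.
have P0 : \prod_(i < n) X i ^- p != 0.
  by apply/prodf_neq0 => i _; rewrite invr_eq0 expf_neq0.
set P := \prod_(i < n) _ in P0 *; set A := alternant _ _ _.
have e (S : K) : S * P * (P^-1 * (S * A)) = S * S * A by field.
by rewrite {}e -expr2 sqrr_sign mul1r.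
Qed.
End Schur.

(** * The shift operators *)

Section Operators.
Variables (K : fieldType) (n : nat) (u v w V : K) (z : 'S_n -> 'I_n -> K).
Hypothesis z0 : forall s j, z s j != 0.

Definition expmon (s : 'S_n) (l : 'I_n -> int) : K := \prod_(j < n) z s j ^ (l j + (j : nat)%:Z).

Lemma expmon_shift s (l : 'I_n -> int) (p : 'I_n) (d : int) :
  expmon s (fun i => l i + (if i == p then d else 0)) = z s p ^ d * expmon s l.
Proof.
rewrite /expmon (bigD1 p) //= [in RHS](bigD1 p) //= eqxx mulrA; congr (_ * _).
  by rewrite /= addrAC [in LHS]expfzDr // mulrC.
by apply: eq_bigr => i /negPf->; rewrite addr0.
Qed.

Lemma factor_expmon (p q : 'I_n) (f : fn K n) (c : 'S_n -> K) :
  (forall l, V * f l = \sum_s c s * expmon s l) ->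
  forall l, V * factor u v w p q f l =
    \sum_s c s * wt2 u v w (z s p) (z s q) * expmon s l.
Proof.
move=> fE l; rewrite /factor /shift !mulrDr !(mulrCA V) !fE !big_distrr -!big_split.
apply: eq_bigr => s _ /=; rewrite !expmon_shift exprN1 expr1z /wt2.
move: (expmon s l) (c s) (z s p) (z s q)^-1 => a b e g; ring.
Qed.

Lemma foldr_factor_expmon (r : seq ('I_n * 'I_n)) (f : fn K n) (c : 'S_n -> K) :
  (forall l, V * f l = \sum_s c s * expmon s l) ->
  forall l, V * foldr (fun pq h => factor u v w pq.1 pq.2 \o h) id r f l =
    \sum_s c s * (\prod_(pq <- r) wt2 u v w (z s pq.1) (z s pq.2)) * expmon s l.
Proof.
move=> fE; elim: r => [|pq r IH] l.
  by rewrite /= fE; apply: eq_bigr => s _; rewrite big_nil mulr1.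
rewrite /= (factor_expmon _ _ IH); apply: eq_bigr => s _.
by rewrite big_cons -!mulrA; congr (_ * _); rewrite mulrCA !mulrA.
Qed.
End Operators.

Theorem amt_rhs_alt (K : fieldType) (u v w : K) (m : nat) (X : 'I_m.+1 -> K) (k : 'I_m.+1 -> int) :
  (forall i, X i != 0) -> injective X ->
  vdm (Xat X) m.+1 * amt_rhs u v w X k = alt u v w (Xat X) m.+1 (natfun k).
Proof.
move=> X0 Xi; rewrite /amt_rhs mulrCA /opprod.
pose z (s : 'S_m.+1) j := X (s j).
have z0 s j : z s j != 0 by exact: X0.
have xE := Xat_ord X.
have sE (l : 'I_m.+1 -> int) : vdm (Xat X) m.+1 * schur_rev X l =
    \sum_s (-1) ^+ odd_perm s * expmon z s l.
  rewrite schur_rev_alternant //; apply: eq_bigr => s _; congr (_ * _).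
  by apply: eq_bigr => j _; rewrite natfunE xE.
rewrite (foldr_factor_expmon u v w z0 _ sE) big_distrr; apply: eq_bigr => s _ /=.
rewrite mulrCA -!mulrA; congr (_ * _); rewrite mulrA mulrC; congr (_ * _).
  by apply: eq_bigr => j _; rewrite natfunE xE.
rewrite (reindex_perm s) /= big_allpairs_dep big_enum /= -big_split; apply: eq_bigr => p _ /=.
rewrite big_filter big_enum_cond /= [RHS](bigD1 p) //= xE mulrC; congr (_ * _).
  by rewrite /wt2 mulfV ?X0 // mulr1.
apply: eq_big => [q|q _]; last by rewrite xE.
by rewrite ltn_neqAle -val_eqE andbC eq_sym.
Qed.

(** * Specialisation to coinciding variables *)

Section Specialization.
Variable F : fieldType.
Local Notation Q := {fraction {poly F}}.

Definition specializes (a : Q) (b : F) : Prop :=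
  exists p q : {poly F}, [/\ q.[0] != 0, a = tofrac p / tofrac q & b = p.[0] / q.[0]].

Lemma tofrac_neq0 (q : {poly F}) : q.[0] != 0 -> tofrac q != 0.
Proof. by rewrite tofrac_eq0; apply: contraNneq => ->; rewrite horner0. Qed.

Lemma spec_poly (p : {poly F}) : specializes (tofrac p) p.[0].
Proof.
by exists p, 1; rewrite hornerC oner_neq0 tofrac1 !divr1.
Qed.

Lemma spec_const (c : F) : specializes (tofrac c%:P) c.
Proof. by have := spec_poly c%:P; rewrite hornerC. Qed.

Lemma spec0 : specializes 0 0.
Proof. by have := spec_const 0; rewrite tofrac0. Qed.

Lemma spec1 : specializes 1 1.
Proof. by have := spec_const 1; rewrite tofrac1. Qed.

Lemma specD a b a' b' : specializes a b -> specializes a' b' -> specializes (a + a') (b + b').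
Proof.
move=> [p [q [q0 -> ->]]] [p' [q' [q0' -> ->]]].
exists (p * q' + p' * q), (q * q'); rewrite hornerD !hornerM; split.
- by rewrite mulf_neq0.
- by rewrite addf_div ?tofrac_neq0 // tofracD !tofracM.
by rewrite addf_div.
Qed.

Lemma specM a b a' b' : specializes a b -> specializes a' b' -> specializes (a * a') (b * b').
Proof.
move=> [p [q [q0 -> ->]]] [p' [q' [q0' -> ->]]].
exists (p * p'), (q * q'); rewrite !hornerM; split.
- by rewrite mulf_neq0.
- by rewrite mulf_div !tofracM.
by rewrite mulf_div.
Qed.

Lemma specV a b : b != 0 -> specializes a b -> specializes a^-1 b^-1.
Proof.
move=> b0 [p [q [q0 -> e]]]; exists q, p; split.
- by apply: contraNneq b0 => p0; rewrite e p0 mul0r.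
- by rewrite invf_div.
by rewrite e invf_div.
Qed.

Lemma spec_sum (I : Type) (r : seq I) (P : pred I) (f : I -> Q) (g : I -> F) :
  (forall i, P i -> specializes (f i) (g i)) ->
  specializes (\sum_(i <- r | P i) f i) (\sum_(i <- r | P i) g i).
Proof.
by move=> fg; elim/big_ind2: _ => // [|? ? ? ?]; [exact: spec0 | exact: specD].
Qed.

Lemma spec_prod (I : Type) (r : seq I) (P : pred I) (f : I -> Q) (g : I -> F) :
  (forall i, P i -> specializes (f i) (g i)) ->
  specializes (\prod_(i <- r | P i) f i) (\prod_(i <- r | P i) g i).
Proof.
by move=> fg; elim/big_ind2: _ => // [|? ? ? ?]; [exact: spec1 | exact: specM].
Qed.

Lemma specX a b (e : nat) : specializes a b -> specializes (a ^+ e) (b ^+ e).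
Proof.
move=> h; elim: e => [|e IH]; first exact: spec1.
by rewrite !exprS; apply: specM.
Qed.

Lemma specXz a b (e : int) : b != 0 -> specializes a b -> specializes (a ^ e) (b ^ e).
Proof.
move=> b0 h; case: e => e; first by rewrite -!exprnP; apply: specX.
by rewrite !NegzE -!invr_expz -!exprnP; apply/specV/specX; rewrite ?expf_neq0.
Qed.

Lemma spec_uniq a b b' : specializes a b -> specializes a b' -> b = b'.
Proof.
move=> h1 h2; have h : specializes 0 (b + (-1) * b').
  have -> : (0 : Q) = a + (-1) * a by rewrite mulN1r subrr.
  apply: specD h1 (specM _ h2).
  by have := spec_const (-1); rewrite polyCN tofracN tofrac1.
case: h => p [q [q0 /esym/eqP e1 e2]].
move: e1; rewrite mulf_eq0 invr_eq0 (negPf (tofrac_neq0 q0)) orbF tofrac_eq0 => /eqP p0.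
by apply/eqP; rewrite -subr_eq0 -mulN1r e2 p0 horner0 mul0r.
Qed.

Section Data.
Variables (n : nat) (u v w : F) (X : 'I_n -> F).
Hypothesis X0 : forall i, X i != 0.

(* Distinct exponents make the perturbed variables pairwise distinct, even when F is
   finite. *)
Definition perturb (i : 'I_n) : Q := tofrac ((X i)%:P + 'X^(i.+1)).
Local Notation cst c := (tofrac (c%:P : {poly F})).

Lemma spec_perturb i : specializes (perturb i) (X i).
Proof.
have := spec_poly ((X i)%:P + 'X^(i.+1)).
by rewrite hornerD hornerC hornerXn expr0n addr0.
Qed.

Lemma perturb_neq0 i : perturb i != 0.
Proof. by apply: tofrac_neq0; rewrite hornerD hornerC hornerXn expr0n addr0. Qed.

Lemma perturb_inj : injective perturb.
Proof.
move=> i j /eqP; rewrite tofrac_eq => /eqP /(congr1 (fun p : {poly F} => p`_i.+1)) /eqP.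
rewrite !coefD !coefC !coefXn /= !add0r eqxx eqSS.
by have [e _|_] := (i =P j :> nat); [apply: val_inj | rewrite oner_eq0].
Qed.

Lemma spec_Xat t : specializes (Xat perturb t) (Xat X t).
Proof. by rewrite /Xat; case: oord => [i|]; [exact: spec_perturb | exact: spec1]. Qed.

Lemma spec_amt_gf k :
  specializes (amt_gf (cst u) (cst v) (cst w) perturb k) (amt_gf u v w X k).
Proof.
apply: spec_sum => TD _; apply: specM; last first.
  by apply: spec_prod => r _; apply: specXz => //; apply: spec_perturb.
by do 2?apply: specM; apply: specX; apply: spec_const.
Qed.

Lemma spec_schur mu : specializes (schur perturb mu) (schur X mu).
Proof. by apply: spec_sum => T _; apply: spec_prod => rc _; apply: spec_Xat. Qed.

Lemma spec_schur_rev l : specializes (schur_rev perturb l) (schur_rev X l).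
Proof.
rewrite /schur_rev /ext_schur; case: ifP => _; first exact: spec0.
case: [pick _ | _] => [s|]; last exact: spec0.
apply: specM; last first.
  by apply: spec_prod => i _; apply: specV; [rewrite expf_neq0 | apply/specX/spec_perturb].
apply: specM; last exact: spec_schur.
by apply: specX; have := spec_const (-1); rewrite polyCN tofracN tofrac1.
Qed.

Lemma spec_opprod (f : fn Q n) (g : fn F n) : (forall l, specializes (f l) (g l)) ->
  forall l, specializes (opprod (cst u) (cst v) (cst w) f l) (opprod u v w g l).
Proof.
move=> fg; rewrite /opprod; elim: [seq _ | p <- _, q <- _] => [|pq r IH] //= l.
by rewrite /factor /shift; do 2?apply: specD; apply: specM => //; apply: spec_const.
Qed.

Lemma spec_amt_rhs k :
  specializes (amt_rhs (cst u) (cst v) (cst w) perturb k) (amt_rhs u v w X k).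
Proof.
apply: specM; last exact/spec_opprod/spec_schur_rev.
apply: spec_prod => i _; apply: specD; last exact: spec_const.
apply: specD; apply: specM; try exact: spec_const; first exact: spec_perturb.
by apply: specV => //; apply: spec_perturb.
Qed.
End Data.

End Specialization.

Theorem theorem1 (F : fieldType) (n : nat) (u v w : F) (X : 'I_n -> F)
  (k : 'I_n -> int) :
  (0 < n)%N ->
  (forall i, X i != 0) ->
  (forall i j : 'I_n, (i < j)%N -> k i < k j) ->
  amt_gf u v w X k = amt_rhs u v w X k.
Proof.
case: n X k => // m X k _ X0 kk.
apply: spec_uniq (spec_amt_gf u v w X0 k) _.
rewrite (_ : amt_gf _ _ _ _ _ = amt_rhs (tofrac u%:P) (tofrac v%:P) (tofrac w%:P) (perturb X) k).
  exact: spec_amt_rhs.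
have P0 i := perturb_neq0 X0 i; have Pi := @perturb_inj _ _ X.
have V0 : vdm (Xat (perturb X)) m.+1 != 0 by exact/vdm_neq0/Xat_neq.
by apply: (mulfI V0); rewrite amt_gf_alt // amt_rhs_alt.
Qed.
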